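(* Let $(\mathcal{X}_1,\mathcal{X}_2,p(y_2|x_1)p(y_3|x_1,x_2,y_2),\mathcal{Y}_2,\mathcal{Y}_3)$ be a discrete memoryless noncausal relay channel with capacity $C_\infty$. Then \begin{align*} C_{\infty} \geq \max \min \{ &I(V,U;Y_3)+I(X_1;U,Y_3|V)-I(U;Y_2|V),\\ & I(V;Y_2)+I(X_1;U,Y_3|V),\\ & I(V;Y_2)+ I(X_1;U,Y_3|V)+I(U;Y_3|V)-I(U;Y_2|V)\}, \end{align*} where the maximum is over all pmfs $p(v,x_1)p(u|v,y_2)$ (with $V,U$ taking values in finite sets) and all functions $x_2(u,v,y_2)$, and the mutual informations are evaluated under the joint distribution $p(v,x_1)p(y_2|x_1)p(u|v,y_2)\mathbf{1}\{x_2=x_2(u,v,y_2)\}p(y_3|x_1,x_2,y_2)$.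
   Context: A discrete memoryless (DM) noncausal relay channel consists of finite alphabets $\mathcal{X}_1,\mathcal{X}_2,\mathcal{Y}_2,\mathcal{Y}_3$ and conditional pmfs $p(y_2|x_1)$ and $p(y_3|x_1,x_2,y_2)$; the sender inputs $X_1$, the relay observes $Y_2$ and inputs $X_2$, the receiver observes $Y_3$. It is memoryless: $p(y_{2i}|x_1^i,y_2^{i-1},m)=p(y_{2i}|x_{1i})$ and $p(y_{3i}|x_1^i,x_2^i,y_2^i,y_3^{i-1},m)=p(y_{3i}|x_{1i},x_{2i},y_{2i})$. A $(2^{nR},n)$ code consists of a message set $[1:2^{nR}]$, an encoder assigning a codeword $x_1^n(m)$ to each message $m$, a relay encoder assigning a symbol $x_{2i}(y_2^n)$ for each $i\in[1:n]$ as a function of the entire received sequence $y_2^n$ (noncausal, i.e., unlimited lookahead), and a decoder assigning an estimate $\hat m(y_3^n)$ or an error. The message $M$ is uniform over $[1:2^{nR}]$, the error probability is $P_e^{(n)}=\mathbb{P}\{\hat M\neq M\}$, a rate $R$ is achievable if there is a sequence of $(2^{nR},n)$ codes with $P_e^{(n)}\to 0$, and the capacity $C_\infty$ is the supremum of achievable rates. *)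

(* Defs.v *)
From HB Require Import structures.
From mathcomp Require Import all_boot all_order all_algebra.
From mathcomp Require Import all_classical all_reals all_analysis.
Set Implicit Arguments. Unset Strict Implicit. Unset Printing Implicit Defensive.
Import Order.TTheory GRing.Theory Num.Theory.
Import numFieldNormedType.Exports.
Local Open Scope ring_scope.
Local Open Scope classical_set_scope.

Section InfoMeasures.
Variable R : realType.

Definition log2 (x : R) : R := ln x / ln 2.

Definition cond_mutinfo (Om TA TB TC : finType) (P : Om -> R)
  (A : Om -> TA) (B : Om -> TB) (C : Om -> TC) : R :=
  \sum_(a : TA) \sum_(b : TB) \sum_(c : TC)
    let pabc := \sum_(t | (A t == a) && (B t == b) && (C t == c)) P t in
    let pac := \sum_(t | (A t == a) && (C t == c)) P t in
    let pbc := \sum_(t | (B t == b) && (C t == c)) P t in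
    let pc := \sum_(t | C t == c) P t in
    if 0 < pabc then pabc * log2 (pabc * pc / (pac * pbc)) else 0.

Definition mutinfo (Om TA TB : finType) (P : Om -> R)
  (A : Om -> TA) (B : Om -> TB) : R :=
  cond_mutinfo P A B (fun _ => tt).
End InfoMeasures.

Section NoncausalRelay.
Variables (R : realType) (X1 X2 Y2 Y3 : finType).
Variable W2 : X1 -> Y2 -> R.
Variable W3 : X1 -> X2 -> Y2 -> Y3 -> R.

(* A code of block length n with M messages (messages 'I_M ~ [1:M]);
   the relay symbol x2i is a function of the whole sequence y2^n;
   the decoder returns Some m or None (= error). *)
Record relay_code (n M : nat) := RelayCode {
  rc_enc : 'I_M -> 'I_n -> X1;
  rc_relay : 'I_n -> {ffun 'I_n -> Y2} -> X2;
  rc_dec : {ffun 'I_n -> Y3} -> option 'I_M }.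

Definition err_prob (n M : nat) (c : relay_code n M) : R :=
  M%:R^-1 * \sum_(m < M) \sum_(y2 : {ffun 'I_n -> Y2})
    ((\prod_(i < n) W2 (rc_enc c m i) (y2 i)) *
     \sum_(y3 : {ffun 'I_n -> Y3})
       ((\prod_(i < n) W3 (rc_enc c m i) (rc_relay c i y2) (y2 i) (y3 i)) *
        (rc_dec c y3 != Some m)%:R)).

Definition num_msgs (rate : R) (n : nat) : nat := Num.truncn (2 `^ (n%:R * rate)).

Definition achievable (rate : R) : Prop :=
  exists c : forall n : nat, relay_code n (num_msgs rate n),
    (fun n => err_prob (c n)) @ \oo --> (0 : R).

Definition capacity_noncausal : \bar R :=
  ereal_sup [set (r%:E)%E | r in achievable].
End NoncausalRelay.

Section JointDist.
Variables (R : realType) (X1 X2 Y2 Y3 V U : finType).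
Variable W2 : X1 -> Y2 -> R.
Variable W3 : X1 -> X2 -> Y2 -> Y3 -> R.
Variable pVX : V -> X1 -> R.
Variable pU : V -> Y2 -> U -> R.
Variable x2f : U -> V -> Y2 -> X2.

(* sample space of (V, X1, Y2, U, Y3); X2 = x2f(U,V,Y2) is deterministic *)
Definition omega := (V * X1 * Y2 * U * Y3)%type.
Definition rvV (t : omega) : V := t.1.1.1.1.
Definition rvX1 (t : omega) : X1 := t.1.1.1.2.
Definition rvY2 (t : omega) : Y2 := t.1.1.2.
Definition rvU (t : omega) : U := t.1.2.
Definition rvY3 (t : omega) : Y3 := t.2.

(* p(v,x1) p(y2|x1) p(u|v,y2) 1{x2 = x2(u,v,y2)} p(y3|x1,x2,y2), x2 summed out *)
Definition joint (t : omega) : R :=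
  pVX (rvV t) (rvX1 t) * W2 (rvX1 t) (rvY2 t) * pU (rvV t) (rvY2 t) (rvU t)
  * W3 (rvX1 t) (x2f (rvU t) (rvV t) (rvY2 t)) (rvY2 t) (rvY3 t).
End JointDist.

(* Main.v *)
Require Import Defs.
From HB Require Import structures.
From mathcomp Require Import all_boot all_order all_algebra.
From mathcomp Require Import all_classical all_reals all_analysis.
From mathcomp Require Import ring lra.
Import Order.TTheory GRing.Theory Num.Theory.
Import numFieldNormedType.Exports.
Local Open Scope ring_scope.
Set Implicit Arguments. Unset Strict Implicit. Unset Printing Implicit Defensive.

(** Split the message as (m', m'') and draw codewords v(m') ~ p(v),
    x1(m', m'') ~ p(x1|v(m')) and u(m', l) ~ p(u|v(m')). The relay draws m' with
    probability proportional to p(y2|v(m')), then l with probability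
    proportional to p(y2|u(m', l), v(m')), and sends x2(u, v, y2). The receiver
    draws (m', m'', l) with probability proportional to
    p(x1, u, y3|v) / (p(x1|v) p(u|v)) and keeps (m', m''). With these stochastic
    likelihood rules the probability of success of a codebook dominates a mean
    of 1/(XYZ), where X, Y, Z are sums over competing codewords; convexity of
    1/(xyz) then reduces the codebook average to first moments, so that neither
    typicality nor a covering or Markov lemma is needed. With L indices l, and
    M', M'' messages of each kind, the error probability is at most the mean of
      min(1, (M'-1) p(y2)/p(y2|v)) + min(1, p(y2|u,v)/(L p(y2|v)))
      + min(1, (M''-1) q1/q) + min(1, (M''-1) L q2/q)
      + min(1, (M'-1) M'' L q3/q)
    for ratios whose expected logarithms are the mutual informations of the
    theorem. For memoryless channels each term decays exponentially, by
    min(1, t) <= t^s with s small, as soon as the corresponding rate inequality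
    holds; randomness at the relay, the receiver and in the codebook is removed
    by averaging. *)

(** * Random coding *)

Section FiniteAverages.
Variable R : realFieldType.

Lemma le_of_eq (x y : R) : x = y -> x <= y.
Proof. by move->. Qed.

(** By distributivity the sum factorizes over the coordinates, and every coordinate other than [i]
    sums to one. *)
Lemma sum_prod_marg1 (I T : finType) (p : T -> R) (i : I) (G : T -> R) :
  \sum_t p t = 1 ->
  \sum_(f : {ffun I -> T}) (\prod_k p (f k)) * G (f i) = \sum_t p t * G t.
Proof.
move=> p1.
transitivity (\sum_(f : {ffun I -> T})
    \prod_k (p (f k) * (if k == i then G (f k) else 1))).
  apply: eq_bigr => f _; rewrite big_split /=; congr (_ * _).
  by rewrite -big_mkcond /= big_pred1_eq.
rewrite -(bigA_distr_bigA (fun k t => p t * (if k == i then G t else 1))).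
rewrite (bigD1 i) //= eqxx [X in _ * X]big1 ?mulr1 // => k /negPf ->.
by under eq_bigr do rewrite mulr1.
Qed.

Lemma sum_prod_marg2 (I T : finType) (p : T -> R) (i j : I) (G : T -> T -> R) :
  \sum_t p t = 1 -> j != i ->
  \sum_(f : {ffun I -> T}) (\prod_k p (f k)) * G (f i) (f j) =
  \sum_a p a * \sum_b p b * G a b.
Proof.
move=> p1 ji.
(* Fixing the value [a] of coordinate [i] by an indicator turns the summand into a product over
   coordinates, so that distributivity applies again. *)
transitivity (\sum_a \sum_(f : {ffun I -> T})
    \prod_k (p (f k) * (if k == i then (f k == a)%:R else
                        if k == j then G a (f k) else 1))).
  rewrite exchange_big; apply: eq_bigr => f _ /=.
  rewrite (bigD1 (f i)) //= [X in _ + X]big1 ?addr0; last first.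
    move=> a nfa; rewrite (bigD1 i) //= eqxx.
    by rewrite eq_sym (negPf nfa) mulr0 mul0r.
  rewrite big_split /=; congr (_ * _).
  rewrite (bigD1 i) //= eqxx eqxx mul1r (bigD1 j) //= (negPf ji) eqxx.
  by rewrite big1 ?mulr1 // => k /andP[/negPf -> /negPf ->].
apply: eq_bigr => a _.
rewrite -(bigA_distr_bigA (fun k t => p t * (if k == i then (t == a)%:R else
                        if k == j then G a t else 1))).
rewrite (bigD1 i) //= (bigD1 j) //= eqxx (negPf ji) eqxx.
rewrite [X in _ * (_ * X)]big1 ?mulr1; last first.
  by move=> k /andP[/negPf -> /negPf ->]; under eq_bigr do rewrite mulr1.
congr (_ * _); rewrite (bigD1 a) //= eqxx mulr1 big1 ?addr0 // => t /negPf ->.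
by rewrite mulr0.
Qed.

Lemma sum_prod1 (I T : finType) (p : I -> T -> R) :
  (forall i, \sum_t p i t = 1) ->
  \sum_(f : {ffun I -> T}) \prod_k p k (f k) = 1.
Proof.
by move=> p1; rewrite -(bigA_distr_bigA p) big1.
Qed.

(** If [g] were below [c] everywhere, a point of positive weight would make the mean strictly
    smaller. This later fixes the random codebook. *)
Lemma exists_ge_average (T : finType) (p g : T -> R) (c : R) :
  (forall t, 0 <= p t) -> \sum_t p t = 1 -> c <= \sum_t p t * g t ->
  exists t, c <= g t.
Proof.
move=> p0 p1 cg; apply/existsP; case: existsP => // no.
have lt t : g t < c by rewrite ltNge; apply/negP => h; apply: no; exists t.
have [t pt] : exists t, 0 < p t.
  apply/existsP; case: existsP => // np.
  suff : \sum_t p t = 0 by rewrite p1 => /eqP; rewrite oner_eq0.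
  apply: big1 => t _; apply/eqP; rewrite eq_le p0 andbT leNgt.
  by apply/negP => h; apply: np; exists t.
suff : \sum_t p t * g t < c by rewrite ltNge cg.
rewrite -[ltRHS]mul1r -p1 mulr_suml (bigD1 t) //= [ltRHS](bigD1 t) //=.
apply: ltr_leD; first by rewrite ltr_pM2l.
by apply: ler_sum => s _; apply: ler_wpM2l => //; apply: ltW.
Qed.

(** For each [a] the point of largest [h a] does at least as well as the random choice; a total
    weight at most one suffices because [h] is nonnegative. This removes the randomness of the relay
    and of the receiver, whose laws lose their mass when all likelihoods vanish. *)
Lemma substochastic_le_deterministic (A T : finType) (t0 : T)
    (k h : A -> T -> R) :
  (forall a t, 0 <= k a t) -> (forall a, \sum_t k a t <= 1) ->
  (forall a t, 0 <= h a t) ->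
  exists f : A -> T, \sum_a \sum_t k a t * h a t <= \sum_a h a (f a).
Proof.
move=> k0 k1 h0; exists (fun a => [arg max_(t > t0) h a t]%O).
apply: ler_sum => a _; case: arg_maxP => // m _ hm.
apply: (@le_trans _ _ (\sum_t k a t * h a m)).
  by apply: ler_sum => t _; apply: ler_wpM2l => //; apply: hm.
by rewrite -mulr_suml -[leRHS]mul1r; apply: ler_wpM2r.
Qed.

(* AM-GM: the tangent plane of the convex function 1/(xyz) at (1,1,1). *)
Lemma inv_mul3_ge_tangent (x y z : R) :
  0 < x -> 0 < y -> 0 < z -> 4 - x - y - z <= (x * y * z)^-1.
Proof.
move=> x0 y0 z0; set w := 4 - x - y - z.
have [neg|w0] := ltP w 0.
  by rewrite (le_trans (ltW neg)) // invr_ge0 !mulr_ge0 // ltW.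
rewrite -[leRHS]mul1r ler_pdivlMr ?mulr_gt0 //.
(* The numbers x, y, z, w sum to 4 and the goal is xyzw <= 1. Pairing them gives xy <= p^2 and zw <=
   (2 - p)^2, and p(2 - p) <= 1. *)
have -> : w * (x * y * z) = (x * y) * (z * w) by ring.
set p := (x + y) / 2.
have xy : x * y <= p ^+ 2 by have := sqr_ge0 (x - y); rewrite /p; lra.
have zw : z * w <= (2 - p) ^+ 2.
  by have := sqr_ge0 (z - w); rewrite /p /w; lra.
apply: (@le_trans _ _ (p ^+ 2 * (2 - p) ^+ 2)).
  by apply: ler_pM => //; apply: mulr_ge0 => //; apply: ltW.
rewrite -exprMn expr_le1 //; last first.
  by apply: mulr_ge0; rewrite /p /w in w0 *; lra.
by have := sqr_ge0 (p - 1); lra.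
Qed.

End FiniteAverages.

(* [sv v y] stands for p(y2|v), [s0 y] for p(y2), [wu v u y] for p(y2|u,v),
   [qd v x u z] for the receiver's metric p(x1,u,y3|v) / (p(x1|v) p(u|v)), and
   [q1], [q2], [q3] for its means over x1 alone, over (x1,u) and over (v,x1,u).
   Requiring only inequalities for the means makes the junk values of divisions
   by zero harmless and the structure stable under products. *)
Record scheme (R : realFieldType) (X1 X2 Y2 Y3 V U : finType)
    (W2 : X1 -> Y2 -> R) (W3 : X1 -> X2 -> Y2 -> Y3 -> R)
    (x2f : U -> V -> Y2 -> X2) := Scheme {
  pV : V -> R;
  pX : V -> X1 -> R;
  pUV : V -> U -> R;
  s0 : Y2 -> R;
  sv : V -> Y2 -> R;
  wu : V -> U -> Y2 -> R;
  qd : V -> X1 -> U -> Y3 -> R;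
  q1 : V -> U -> Y3 -> R;
  q2 : V -> Y3 -> R;
  q3 : Y3 -> R;
  joint_of := fun v x y u z => pV v * pX v x * W2 x y * pUV v u *
    (wu v u y / sv v y) * W3 x (x2f u v y) y z;
  W2_ge0 : forall x y, 0 <= W2 x y;
  W2_sum : forall x, \sum_y W2 x y = 1;
  W3_ge0 : forall x x2 y z, 0 <= W3 x x2 y z;
  W3_sum : forall x x2 y, \sum_z W3 x x2 y z = 1;
  pV_ge0 : forall v, 0 <= pV v;
  pV_sum : \sum_v pV v = 1;
  pX_ge0 : forall v x, 0 <= pX v x;
  pX_sum : forall v, \sum_x pX v x = 1;
  pUV_ge0 : forall v u, 0 <= pUV v u;
  pUV_sum : forall v, \sum_u pUV v u = 1;
  sv_ge0 : forall v y, 0 <= sv v y;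
  wu_ge0 : forall v u y, 0 <= wu v u y;
  qd_ge0 : forall v x u z, 0 <= qd v x u z;
  sv_avg : forall y, \sum_v pV v * sv v y <= s0 y;
  wu_avg : forall v y, \sum_u pUV v u * wu v u y <= sv v y;
  qd_avg1 : forall v u z, \sum_x pX v x * qd v x u z <= q1 v u z;
  qd_avg2 : forall v z, \sum_x \sum_u pX v x * pUV v u * qd v x u z <= q2 v z;
  qd_avg3 : forall z,
    \sum_v \sum_x \sum_u pV v * pX v x * pUV v u * qd v x u z <= q3 z;
  joint_qd : forall v x y u z, joint_of v x y u z != 0 -> qd v x u z != 0;
  joint_sum : \sum_y \sum_z \sum_v \sum_x \sum_u joint_of v x y u z = 1 }.

(** * One-shot random code built on a scheme *)

Section OneShot.
Variables (R : realFieldType) (X1 X2 Y2 Y3 V U : finType).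
Variables (W2 : X1 -> Y2 -> R) (W3 : X1 -> X2 -> Y2 -> Y3 -> R).
Variable x2f : U -> V -> Y2 -> X2.
Variable S : scheme W2 W3 x2f.
Variables a b c : nat.
Local Notation pV := (pV S).
Local Notation pX := (pX S).
Local Notation pUV := (pUV S).
Local Notation s0 := (s0 S).
Local Notation sv := (sv S).
Local Notation wu := (wu S).
Local Notation qd := (qd S).
Local Notation q1 := (q1 S).
Local Notation q2 := (q2 S).
Local Notation q3 := (q3 S).
Local Notation L := (c.+1%:R : R).

(** Mean under p(v) p(x1|v) p(u|v), with X1 and U independent given V: the law of one triple of
    codewords, as opposed to the joint law of the theorem. *)
Definition avg3 (G : V -> X1 -> U -> R) : R :=
  \sum_v \sum_x \sum_u pV v * pX v x * pUV v u * G v x u.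

(** All that belongs to one m': the cloud center v with its codewords x1 and u. The successors keep
    the index sets inhabited, so [a], [b], [c] count the competitors of a given index. *)
Definition codeword_cluster := (V * {ffun 'I_b.+1 -> X1} * {ffun 'I_c.+1 -> U})%type.
Definition pK (k : codeword_cluster) : R :=
  pV k.1.1 * (\prod_j pX k.1.1 (k.1.2 j)) * \prod_l pUV k.1.1 (k.2 l).
Definition codebook := {ffun 'I_a.+1 -> codeword_cluster}.
Definition pC (C : codebook) : R := \prod_i pK (C i).

Lemma avg3_le G G' :
  (forall v x u, pV v * pX v x * pUV v u * G v x u <=
                 pV v * pX v x * pUV v u * G' v x u) -> avg3 G <= avg3 G'.
Proof. by move=> h; do 3 (apply: ler_sum => ? _). Qed.

Lemma p3_ge0 v x u : 0 <= pV v * pX v x * pUV v u.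
Proof. by rewrite !mulr_ge0 ?pV_ge0 ?pX_ge0 ?pUV_ge0. Qed.

Lemma pK_ge0 k : 0 <= pK k.
Proof.
by rewrite !mulr_ge0 ?pV_ge0 // prodr_ge0 // => ? _; rewrite ?pX_ge0 ?pUV_ge0.
Qed.

Lemma sum_pK (F : V -> {ffun 'I_b.+1 -> X1} -> {ffun 'I_c.+1 -> U} -> R) :
  \sum_k pK k * F k.1.1 k.1.2 k.2 =
  \sum_v pV v * \sum_(x : {ffun 'I_b.+1 -> X1}) (\prod_j pX v (x j)) *
    \sum_(u : {ffun 'I_c.+1 -> U}) (\prod_l pUV v (u l)) * F v x u.
Proof.
under [RHS]eq_bigr => v _ do rewrite mulr_sumr.
rewrite pair_bigA /=.
under [RHS]eq_bigr => p _ do rewrite !mulr_sumr.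
rewrite pair_bigA /=; apply: eq_bigr => -[[v x] u] _ /=.
by rewrite /pK /= !mulrA.
Qed.

Lemma pK_marg j l (G : V -> X1 -> U -> R) :
  \sum_k pK k * G k.1.1 (k.1.2 j) (k.2 l) = avg3 G.
Proof.
rewrite (sum_pK (fun v x u => G v (x j) (u l))); apply: eq_bigr => v _.
under eq_bigr => x _ do
  rewrite (sum_prod_marg1 l (fun u => G v (x j) u) (pUV_sum S v)).
rewrite (sum_prod_marg1 j (fun x => \sum_u pUV v u * G v x u) (pX_sum S v)).
rewrite mulr_sumr; apply: eq_bigr => x _; rewrite !mulr_sumr.
by apply: eq_bigr => u _; rewrite !mulrA.
Qed.

Lemma pK_sum : \sum_k pK k = 1.
Proof.
under eq_bigr => k _ do rewrite -[pK k]mulr1.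
rewrite (sum_pK (fun _ _ _ => 1)) -[RHS](pV_sum S); apply: eq_bigr => v _.
rewrite -[RHS]mulr1; congr (_ * _).
rewrite -[RHS](sum_prod1 (p := fun _ : 'I_b.+1 => pX v)); last by move=> _; apply: pX_sum.
apply: eq_bigr => x _; rewrite -[RHS]mulr1; congr (_ * _).
rewrite -[RHS](sum_prod1 (p := fun _ : 'I_c.+1 => pUV v)); last by move=> _; apply: pUV_sum.
by under eq_bigr do rewrite mulr1.
Qed.

(** Given v, codewords with distinct indices are independent, so a factor evaluated at a competing
    index may be replaced by its conditional mean. The competitor differs in u here, and in x or in
    both below. *)
Lemma pK_marg_u j l l' (G : V -> X1 -> U -> R) (g : V -> U -> R) : l' != l ->
  \sum_k pK k * (G k.1.1 (k.1.2 j) (k.2 l) * g k.1.1 (k.2 l')) =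
  avg3 (fun v x u => G v x u * \sum_u' pUV v u' * g v u').
Proof.
move=> ll; rewrite (sum_pK (fun v x u => G v (x j) (u l) * g v (u l'))).
apply: eq_bigr => v _.
under eq_bigr => x _ do rewrite
  (sum_prod_marg2 (fun u u' => G v (x j) u * g v u') (pUV_sum S v) ll).
rewrite (sum_prod_marg1 j (fun x => \sum_u pUV v u *
  \sum_u' pUV v u' * (G v x u * g v u')) (pX_sum S v)).
rewrite mulr_sumr; apply: eq_bigr => x _; rewrite !mulr_sumr.
apply: eq_bigr => u _; rewrite !mulr_sumr; apply: eq_bigr => u' _; ring.
Qed.

Lemma pK_marg_x j j' l (G g : V -> X1 -> U -> R) : j' != j ->
  \sum_k pK k * (G k.1.1 (k.1.2 j) (k.2 l) * g k.1.1 (k.1.2 j') (k.2 l)) =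
  avg3 (fun v x u => G v x u * \sum_x' pX v x' * g v x' u).
Proof.
move=> jj; rewrite (sum_pK (fun v x u => G v (x j) (u l) * g v (x j') (u l))).
apply: eq_bigr => v _.
under eq_bigr => x _ do rewrite
  (sum_prod_marg1 l (fun u => G v (x j) u * g v (x j') u) (pUV_sum S v)).
rewrite (sum_prod_marg2 (fun x x' => \sum_u pUV v u * (G v x u * g v x' u))
  (pX_sum S v) jj).
rewrite mulr_sumr; apply: eq_bigr => x _; rewrite !mulr_sumr.
under [LHS]eq_bigr => x' _ do rewrite !mulr_sumr.
rewrite exchange_big; apply: eq_bigr => u _ /=.
rewrite !mulr_sumr; apply: eq_bigr => x' _; ring.
Qed.

Lemma pK_marg_xu j j' l l' (G g : V -> X1 -> U -> R) : j' != j -> l' != l ->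
  \sum_k pK k * (G k.1.1 (k.1.2 j) (k.2 l) * g k.1.1 (k.1.2 j') (k.2 l')) =
  avg3 (fun v x u => G v x u * \sum_x' \sum_u' pX v x' * pUV v u' * g v x' u').
Proof.
move=> jj ll.
rewrite (sum_pK (fun v x u => G v (x j) (u l) * g v (x j') (u l'))).
apply: eq_bigr => v _.
under eq_bigr => x _ do rewrite
  (sum_prod_marg2 (fun u u' => G v (x j) u * g v (x j') u') (pUV_sum S v) ll).
rewrite (sum_prod_marg2 (fun x x' => \sum_u pUV v u *
  \sum_u' pUV v u' * (G v x u * g v x' u')) (pX_sum S v) jj).
rewrite mulr_sumr; apply: eq_bigr => x _; rewrite !mulr_sumr.
under [LHS]eq_bigr => x' _ do rewrite !mulr_sumr.
rewrite exchange_big; apply: eq_bigr => u _ /=.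
rewrite !mulr_sumr; apply: eq_bigr => x' _; rewrite !mulr_sumr.
apply: eq_bigr => u' _; ring.
Qed.

(** * First moments of the competing weights around a fixed sent triple *)

Section TrueCodeword.
Variables (i : 'I_a.+1) (j : 'I_b.+1) (l : 'I_c.+1).
Variable G : V -> X1 -> U -> R.
Hypothesis G0 : forall v x u, 0 <= G v x u.
Local Notation GC C := (G (C i).1.1 ((C i).1.2 j) ((C i).2 l)).

Lemma pC_marg : \sum_(C : codebook) pC C * GC C = avg3 G.
Proof.
rewrite (sum_prod_marg1 i (fun k : codeword_cluster => G k.1.1 (k.1.2 j) (k.2 l)) pK_sum).
exact: pK_marg.
Qed.

Lemma pC_marg_out i' (g : codeword_cluster -> R) : i' != i ->
  \sum_(C : codebook) pC C * (GC C * g (C i')) =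
  avg3 (fun v x u => G v x u * \sum_k pK k * g k).
Proof.
move=> ii; rewrite (sum_prod_marg2
  (fun k k' : codeword_cluster => G k.1.1 (k.1.2 j) (k.2 l) * g k') pK_sum ii).
rewrite -(pK_marg j l); apply: eq_bigr => k _; congr (_ * _).
by rewrite mulr_sumr; apply: eq_bigr => k' _; rewrite mulrCA.
Qed.

(** The true index contributes [wu], each of the [c] others at most [sv] on average. Rounding [c] up
    to L makes the total equal to (1 + tB) L sv where [sv] is nonzero, with [tB] defined below. *)
Lemma mean_wu y :
  \sum_(C : codebook) pC C * (GC C * \sum_l' wu (C i).1.1 ((C i).2 l') y) <=
  avg3 (fun v x u => G v x u * (wu v u y + L * sv v y)).
Proof.
rewrite (sum_prod_marg1 i (fun k : codeword_cluster => G k.1.1 (k.1.2 j) (k.2 l) *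
  \sum_l' wu k.1.1 (k.2 l') y) pK_sum).
under eq_bigr => k _ do rewrite !mulr_sumr.
rewrite exchange_big (bigD1 l) //=.
rewrite (pK_marg j l (fun v x u => G v x u * wu v u y)).
under eq_bigr => l' ll do
  rewrite (pK_marg_u j G (fun v u => wu v u y) ll).
rewrite sumr_const cardC1 card_ord /=.
have -> : avg3 (fun v x u => G v x u * (wu v u y + L * sv v y)) =
    avg3 (fun v x u => G v x u * wu v u y) +
    avg3 (fun v x u => G v x u * sv v y) * L.
  rewrite /avg3 mulr_suml -big_split; apply: eq_bigr => v _ /=.
  rewrite mulr_suml -big_split; apply: eq_bigr => x _ /=.
  rewrite mulr_suml -big_split; apply: eq_bigr => u _ /=; ring.
rewrite lerD2l -[leLHS]mulr_natr.
have h0 : 0 <= avg3 (fun v x u => G v x u * sv v y).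
  by do 3 (apply: sumr_ge0 => ? _); rewrite !mulr_ge0 ?pV_ge0 ?pX_ge0 ?pUV_ge0 ?sv_ge0 ?G0.
apply: (@le_trans _ _ (avg3 (fun v x u => G v x u * sv v y) * c%:R)).
  apply: ler_wpM2r => //; apply: avg3_le => v x u.
  by do 2 (apply: ler_wpM2l; rewrite ?p3_ge0 ?G0 //); apply: wu_avg.
by apply: ler_wpM2l => //; rewrite ler_nat.
Qed.

(** The true cluster contributes [sv], each of the [a] others at most [s0] on average, by
    independence of the clusters. *)
Lemma mean_sv y :
  \sum_(C : codebook) pC C * (GC C * \sum_i' sv (C i').1.1 y) <=
  avg3 (fun v x u => G v x u * (sv v y + a%:R * s0 y)).
Proof.
under eq_bigr => C _ do rewrite !mulr_sumr.
rewrite exchange_big (bigD1 i) //=.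
rewrite (sum_prod_marg1 i (fun k : codeword_cluster => G k.1.1 (k.1.2 j) (k.2 l) *
  sv k.1.1 y) pK_sum).
rewrite (pK_marg j l (fun v x u => G v x u * sv v y)).
under eq_bigr => i' ii do
  rewrite (pC_marg_out (fun k : codeword_cluster => sv k.1.1 y) ii).
rewrite sumr_const cardC1 card_ord /=.
have -> : avg3 (fun v x u => G v x u * (sv v y + a%:R * s0 y)) =
    avg3 (fun v x u => G v x u * sv v y) +
    avg3 (fun v x u => G v x u * s0 y) * a%:R.
  rewrite /avg3 mulr_suml -big_split; apply: eq_bigr => v _ /=.
  rewrite mulr_suml -big_split; apply: eq_bigr => x _ /=.
  rewrite mulr_suml -big_split; apply: eq_bigr => u _ /=; ring.
rewrite lerD2l -[leLHS]mulr_natr.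
apply: ler_wpM2r => //; apply: avg3_le => v x u.
do 2 (apply: ler_wpM2l; rewrite ?p3_ge0 ?G0 //).
rewrite (pK_marg j l (fun v _ _ => sv v y)); apply: le_trans (sv_avg S y).
apply: ler_sum => v' _; under eq_bigr => x' _.
  under eq_bigr => u' _ do rewrite mulrAC.
  rewrite -mulr_sumr pUV_sum mulr1 mulrAC; over.
by rewrite -mulr_sumr pX_sum mulr1.
Qed.

(* Weight given by the receiver to the pairs other than (i, j); the triples
   (i, j, l') with l' <> l decode to the right message, so they do not count. *)
Definition wrong_weight (C : codebook) z :=
  \sum_(j' | j' != j) \sum_l' qd (C i).1.1 ((C i).1.2 j') ((C i).2 l') z +
  \sum_(i' | i' != i) \sum_j' \sum_l'
    qd (C i').1.1 ((C i').1.2 j') ((C i').2 l') z.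

(** Competitors fall into three classes: a wrong m'' with the true l (mean [q1]), a wrong m'' with a
    wrong l (mean [q2]), and a wrong m' with any m'' and l (mean [q3]). *)
Lemma mean_wrong z :
  \sum_(C : codebook) pC C * (GC C * wrong_weight C z) <=
  avg3 (fun v x u => G v x u * (b%:R * q1 v u z + b%:R * L * q2 v z +
                                a%:R * b.+1%:R * L * q3 z)).
Proof.
under eq_bigr => C _ do rewrite !mulrDr.
rewrite big_split /=.
have -> : avg3 (fun v x u => G v x u * (b%:R * q1 v u z + b%:R * L * q2 v z +
    a%:R * b.+1%:R * L * q3 z)) =
  (avg3 (fun v x u => G v x u * q1 v u z) +
   avg3 (fun v x u => G v x u * q2 v z) * L) * b%:R +
   avg3 (fun v x u => G v x u * q3 z) * L * b.+1%:R * a%:R.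
  rewrite /avg3 mulrDl !mulr_suml -!big_split; apply: eq_bigr => v _ /=.
  rewrite !mulr_suml -!big_split; apply: eq_bigr => x _ /=.
  rewrite !mulr_suml -!big_split; apply: eq_bigr => u _ /=; ring.
apply: lerD.
  under eq_bigr => C _ do rewrite !mulr_sumr.
  rewrite exchange_big /=.
  have -> : b%:R = #|predC1 j|%:R :> R by rewrite cardC1 card_ord.
  rewrite mulr_natr -sumr_const; apply: ler_sum => j' jj.
  rewrite (sum_prod_marg1 i (fun k : codeword_cluster => G k.1.1 (k.1.2 j) (k.2 l) *
    \sum_l' qd k.1.1 (k.1.2 j') (k.2 l') z) pK_sum).
  under eq_bigr => k _ do rewrite !mulr_sumr.
  rewrite exchange_big (bigD1 l) //=.
  rewrite (pK_marg_x l G (fun v x u => qd v x u z) jj).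
  under eq_bigr => l' ll do
    rewrite (pK_marg_xu G (fun v x u => qd v x u z) jj ll).
  rewrite sumr_const cardC1 card_ord /= -[X in _ + X <= _]mulr_natr; apply: lerD.
    apply: avg3_le => v x u.
    by do 2 (apply: ler_wpM2l; rewrite ?p3_ge0 ?G0 //); apply: qd_avg1.
  have le2 : avg3 (fun v x u => G v x u *
       \sum_x' \sum_u' pX v x' * pUV v u' * qd v x' u' z) <=
      avg3 (fun v x u => G v x u * q2 v z).
    apply: avg3_le => v x u.
    by do 2 (apply: ler_wpM2l; rewrite ?p3_ge0 ?G0 //); apply: qd_avg2.
  apply: ler_pM => //; last by rewrite ler_nat.
  do 3 (apply: sumr_ge0 => ? _); rewrite !mulr_ge0 ?pV_ge0 ?pX_ge0 ?pUV_ge0 ?G0 //.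
  do 2 (apply: sumr_ge0 => ? _).
  by rewrite !mulr_ge0 ?pX_ge0 ?pUV_ge0 ?qd_ge0.
under eq_bigr => C _ do rewrite !mulr_sumr.
rewrite exchange_big /=.
have -> : a%:R = #|predC1 i|%:R :> R by rewrite cardC1 card_ord.
rewrite mulr_natr -sumr_const; apply: ler_sum => i' ii.
under eq_bigr => C _ do rewrite !mulr_sumr.
rewrite exchange_big /=.
have -> : b.+1%:R = #|'I_b.+1|%:R :> R by rewrite card_ord.
rewrite mulr_natr -sumr_const; apply: ler_sum => j' _.
under eq_bigr => C _ do rewrite !mulr_sumr.
rewrite exchange_big /=.
have -> : L = #|'I_c.+1|%:R :> R by rewrite card_ord.
rewrite mulr_natr -sumr_const; apply: ler_sum => l' _.
rewrite (pC_marg_out (fun k : codeword_cluster => qd k.1.1 (k.1.2 j') (k.2 l') z) ii).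
apply: avg3_le => v x u; do 2 (apply: ler_wpM2l; rewrite ?p3_ge0 ?G0 //).
by rewrite (pK_marg j' l' (fun v x u => qd v x u z)); apply: qd_avg3.
Qed.

End TrueCodeword.

(** In [tA] and [tC] the mean weight of the competitors is compared with that of the true codeword.
    In [tB] the roles are reversed: the weight of one u is compared with the mean weight of the
    whole list, and a small value means that the list is rich enough. *)
Definition tA v y := a%:R * s0 y / sv v y.
Definition tB v u y := wu v u y / (L * sv v y).
Definition tC v x u z := (b%:R * q1 v u z + b%:R * L * q2 v z +
                          a%:R * b.+1%:R * L * q3 z) / qd v x u z.
(** Contribution of one triple to the success if each random sum equalled the bound on its mean: the
    relay finds m' with probability 1/(1 + tA) and then l with probability tB/(1 + tB), and the
    receiver is right with probability 1/(1 + tC). *)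
Definition target v x u y z : R := W2 x y * tB v u y * W3 x (x2f u v y) y z /
  ((1 + tA v y) * (1 + tB v u y) * (1 + tC v x u z)).

Lemma s0_ge0 y : 0 <= s0 y.
Proof.
apply: le_trans (sv_avg S y).
by apply: sumr_ge0 => v _; rewrite mulr_ge0 ?pV_ge0 ?sv_ge0.
Qed.

Lemma q1_ge0 v u z : 0 <= q1 v u z.
Proof.
apply: le_trans (qd_avg1 S v u z).
by apply: sumr_ge0 => x _; rewrite mulr_ge0 ?pX_ge0 ?qd_ge0.
Qed.

Lemma q2_ge0 v z : 0 <= q2 v z.
Proof.
apply: le_trans (qd_avg2 S v z).
by do 2 (apply: sumr_ge0 => ? _); rewrite !mulr_ge0 ?pX_ge0 ?pUV_ge0 ?qd_ge0.
Qed.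

Lemma q3_ge0 z : 0 <= q3 z.
Proof.
apply: le_trans (qd_avg3 S z); do 3 (apply: sumr_ge0 => ? _).
by rewrite !mulr_ge0 ?pV_ge0 ?pX_ge0 ?pUV_ge0 ?qd_ge0.
Qed.

Lemma tA_ge0 v y : 0 <= tA v y.
Proof. by rewrite mulr_ge0 ?invr_ge0 ?sv_ge0 // mulr_ge0 ?s0_ge0. Qed.

Lemma tB_ge0 v u y : 0 <= tB v u y.
Proof. by rewrite mulr_ge0 ?invr_ge0 ?mulr_ge0 ?sv_ge0 // wu_ge0. Qed.

Lemma tC_ge0 v x u z : 0 <= tC v x u z.
Proof.
by rewrite mulr_ge0 ?invr_ge0 ?qd_ge0 // !addr_ge0 // !mulr_ge0 // ?q1_ge0
  ?q2_ge0 ?q3_ge0.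
Qed.

Lemma target_ge0 v x u y z : 0 <= target v x u y z.
Proof.
have W2p := W2_ge0 S; have W3p := W3_ge0 S.
apply: divr_ge0; first by apply: mulr_ge0 => //; apply: mulr_ge0 => //;
  apply: tB_ge0.
apply: mulr_ge0; first apply: mulr_ge0.
- by rewrite addr_ge0 ?tA_ge0.
- by rewrite addr_ge0 ?tB_ge0.
- by rewrite addr_ge0 ?tC_ge0.
Qed.

(** * Stochastic likelihood rules and their mean success probability *)

Definition relay_law (C : codebook) y (kl : 'I_a.+1 * 'I_c.+1) : R :=
  sv (C kl.1).1.1 y / (\sum_k sv (C k).1.1 y) *
  (wu (C kl.1).1.1 ((C kl.1).2 kl.2) y /
   \sum_l wu (C kl.1).1.1 ((C kl.1).2 l) y).

Definition dec_law (C : codebook) z (ij : 'I_a.+1 * 'I_b.+1) : R :=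
  (\sum_l qd (C ij.1).1.1 ((C ij.1).1.2 ij.2) ((C ij.1).2 l) z) /
  \sum_i \sum_j \sum_l qd (C i).1.1 ((C i).1.2 j) ((C i).2 l) z.

Lemma relay_law_ge0 C y kl : 0 <= relay_law C y kl.
Proof.
by rewrite /relay_law mulr_ge0 // divr_ge0 ?sumr_ge0 ?sv_ge0 ?wu_ge0 // => *;
  rewrite ?sv_ge0 ?wu_ge0.
Qed.

Lemma dec_law_ge0 C z ij : 0 <= dec_law C z ij.
Proof.
by rewrite /dec_law divr_ge0 //; do ?(apply: sumr_ge0 => ? _); rewrite qd_ge0.
Qed.

Lemma divff_le1 (t : R) : t / t <= 1.
Proof. by have [->|t0] := eqVneq t 0; rewrite ?mul0r // divff. Qed.

Lemma relay_law_sum C y : \sum_kl relay_law C y kl <= 1.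
Proof.
rewrite -(pair_bigA _ (fun k l => relay_law C y (k, l))) /=.
apply: (@le_trans _ _ (\sum_k sv (C k).1.1 y / (\sum_k sv (C k).1.1 y))).
  apply: ler_sum => k _; rewrite /relay_law /= -mulr_sumr -[leRHS]mulr1.
  apply: ler_wpM2l; last by rewrite -mulr_suml divff_le1.
  by rewrite divr_ge0 ?sumr_ge0 ?sv_ge0 // => *; rewrite sv_ge0.
by rewrite -mulr_suml divff_le1.
Qed.

Lemma dec_law_sum C z : \sum_ij dec_law C z ij <= 1.
Proof.
rewrite /dec_law -mulr_suml -(pair_bigA _ (fun i j =>
  \sum_l qd (C i).1.1 ((C i).1.2 j) ((C i).2 l) z)) /=; exact: divff_le1.
Qed.

(** The weights of the other l' with the same pair enter both numerator and denominator; dropping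
    them from both can only lower the ratio. *)
Lemma dec_law_ge (C : codebook) z i j l
    (qt := qd (C i).1.1 ((C i).1.2 j) ((C i).2 l) z) :
  qt / (qt + wrong_weight i j C z) <= dec_law C z (i, j).
Proof.
have [q0|qn0] := eqVneq qt 0; first by rewrite q0 mul0r dec_law_ge0.
have qt0 : 0 < qt by rewrite lt_def qn0 qd_ge0.
have w0 : 0 <= wrong_weight i j C z.
  by rewrite addr_ge0 //; do ?(apply: sumr_ge0 => ? _); rewrite qd_ge0.
rewrite /dec_law (bigD1 i) //= (bigD1 j) //= -addrA -/(wrong_weight i j C z).
set T := \sum_l' _.
have qT : qt <= T.
  rewrite /T (bigD1 l) //= lerDl; apply: sumr_ge0 => ? _; exact: qd_ge0.
rewrite ler_pdivrMr ?(ltr_pwDl qt0) // mulrAC ler_pdivlMr; last first.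
  by rewrite (lt_le_trans qt0) // (le_trans qT) // lerDl.
by move: (wrong_weight i j C z) w0 => Wr w0; nra.
Qed.

Lemma succ_term_ge0 C x x2 y z kl ij :
  0 <= W2 x y * relay_law C y kl * W3 x x2 y z * dec_law C z ij.
Proof.
apply: mulr_ge0; last exact: dec_law_ge0.
apply: mulr_ge0; last exact: (W3_ge0 S).
apply: mulr_ge0; last exact: relay_law_ge0.
exact: (W2_ge0 S).
Qed.

Definition success (C : codebook) i j : R :=
  \sum_y \sum_z \sum_kl W2 ((C i).1.2 j) y * relay_law C y kl *
    W3 ((C i).1.2 j) (x2f ((C kl.1).2 kl.2) (C kl.1).1.1 y) y z *
    dec_law C z (i, j).

(* Lower bound of the success probability by the tangent plane of 1/(xyz) at
   the conditional means 1 + tB, 1 + tC, 1 + tA of X, Y, Z. *)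
Definition tangent (C : codebook) i j l y z : R :=
  let v := (C i).1.1 in let x := (C i).1.2 j in let u := (C i).2 l in
  let h := target v x u y z in
  4 * h - h / ((1 + tB v u y) * (L * sv v y)) * (\sum_l' wu v ((C i).2 l') y)
  - (h / (1 + tC v x u z) + h / ((1 + tC v x u z) * qd v x u z) * wrong_weight i j C z)
  - h / ((1 + tA v y) * sv v y) * \sum_i' sv (C i').1.1 y.

(** Where [target] vanishes, so does [tangent]. Elsewhere a codebook of positive probability makes
    [joint_of] nonzero, hence [qd] positive, all divisions are genuine, and the tangent inequality
    applies to the three sums divided by their mean bounds. *)
Lemma tangent_le C i j l y z : pC C != 0 ->
  tangent C i j l y z <= W2 ((C i).1.2 j) y * relay_law C y (i, l) *
    W3 ((C i).1.2 j) (x2f ((C i).2 l) (C i).1.1 y) y z * dec_law C z (i, j).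
Proof.
move=> pC0; rewrite /tangent.
set v := (C i).1.1; set x := (C i).1.2 j; set u := (C i).2 l => /=.
set h := target v x u y z.
have [h0|hn0] := eqVneq h 0.
  rewrite h0 !mul0r mulr0 addr0 !subr0; exact: succ_term_ge0.
have hgt0 : 0 < h by rewrite lt_def hn0 target_ge0.
have W20 : W2 x y != 0.
  by apply: contraNneq hn0 => e; rewrite /h /target e !mul0r.
have W30 : W3 x (x2f u v y) y z != 0.
  by apply: contraNneq hn0 => e; rewrite /h /target e mulr0 mul0r.
have wn0 : wu v u y != 0.
  by apply: contraNneq hn0 => e; rewrite /h /target {1}/tB e !(mul0r, mulr0).
have sn0 : sv v y != 0.
  by apply: contraNneq hn0 => e;
    rewrite /h /target {1}/tB e !(mul0r, mulr0, invr0).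
have : pK (C i) != 0.
  by apply: contraNneq pC0 => pK0; rewrite /pC (bigD1 i) //= pK0 mul0r.
rewrite /pK !mulf_eq0 !negb_or -/v -andbA => /and3P[pV0 pX0 pU0].
have {}pX0 : pX v x != 0.
  by apply: contraNneq pX0 => e; rewrite (bigD1 j) //= -/x e mul0r.
have {}pU0 : pUV v u != 0.
  by apply: contraNneq pU0 => e; rewrite (bigD1 l) //= -/u e mul0r.
have qn0 : qd v x u z != 0.
  apply: (@joint_qd _ _ _ _ _ _ _ _ _ _ S v x y u z).
  by rewrite !mulf_neq0 // invr_neq0.
have s_gt0 : 0 < sv v y by rewrite lt_def sn0 sv_ge0.
have w_gt0 : 0 < wu v u y by rewrite lt_def wn0 wu_ge0.
have q_gt0 : 0 < qd v x u z by rewrite lt_def qn0 qd_ge0.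
set Sw := \sum_l' _; set Ss := \sum_i' _; set Wr := wrong_weight i j C z.
have Sw_gt0 : 0 < Sw.
  rewrite /Sw (bigD1 l) //= ltr_pwDl //; apply: sumr_ge0 => *; exact: wu_ge0.
have Ss_gt0 : 0 < Ss.
  rewrite /Ss (bigD1 i) //= ltr_pwDl //; apply: sumr_ge0 => *; exact: sv_ge0.
have Wr_ge0 : 0 <= Wr.
  by rewrite addr_ge0 //; do ?(apply: sumr_ge0 => ? _); rewrite qd_ge0.
have A_gt0 : 0 < 1 + tA v y by rewrite ltr_pwDl // tA_ge0.
have B_gt0 : 0 < 1 + tB v u y by rewrite ltr_pwDl // tB_ge0.
have C_gt0 : 0 < 1 + tC v x u z by rewrite ltr_pwDl // tC_ge0.
have L_gt0 : 0 < L by rewrite ltr0n.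
have qW_gt0 : 0 < qd v x u z + Wr by rewrite ltr_pwDl.
have := @inv_mul3_ge_tangent R (Sw / ((1 + tB v u y) * (L * sv v y)))
  ((qd v x u z + Wr) / ((1 + tC v x u z) * qd v x u z))
  (Ss / ((1 + tA v y) * sv v y)).
rewrite !divr_gt0 ?mulr_gt0 // => /(_ isT isT isT).
rewrite -(ler_pM2l hgt0) => ineq.
apply: (@le_trans _ _ (W2 x y * (sv v y / Ss * (wu v u y / Sw)) *
   W3 x (x2f u v y) y z * (qd v x u z / (qd v x u z + Wr)))); last first.
  apply: ler_wpM2l; last exact: dec_law_ge.
  have W2p := W2_ge0 S x y; have W3p := W3_ge0 S x (x2f u v y) y z.
  by rewrite !mulr_ge0 ?invr_ge0 // ltW.
apply: le_trans (le_trans ineq _); apply: le_of_eq.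
  by field; rewrite nat1r !lt0r_neq0.
rewrite /h /target [in X in X * W3 _ _ _ _]/tB.
by field; rewrite nat1r !lt0r_neq0.
Qed.

(** By the first moment bounds, each of the three subtracted terms has mean at most that of
    [target], which leaves 4 - 3 = 1 copy of it. *)
Lemma mean_tangent i j l y z :
  avg3 (fun v x u => target v x u y z) <=
  \sum_(C : codebook) pC C * tangent C i j l y z.
Proof.
pose tgt v x u := target v x u y z.
have split_sum : \sum_(C : codebook) pC C * tangent C i j l y z =
  avg3 (fun v x u => 4 * tgt v x u)
  - (\sum_(C : codebook) pC C * (tgt (C i).1.1 ((C i).1.2 j) ((C i).2 l) /
      ((1 + tB (C i).1.1 ((C i).2 l) y) * (L * sv (C i).1.1 y)) *
      \sum_l' wu (C i).1.1 ((C i).2 l') y))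
  - (avg3 (fun v x u => tgt v x u / (1 + tC v x u z)) +
     \sum_(C : codebook) pC C * (tgt (C i).1.1 ((C i).1.2 j) ((C i).2 l) /
      ((1 + tC (C i).1.1 ((C i).1.2 j) ((C i).2 l) z) *
       qd (C i).1.1 ((C i).1.2 j) ((C i).2 l) z) * wrong_weight i j C z))
  - (\sum_(C : codebook) pC C * (tgt (C i).1.1 ((C i).1.2 j) ((C i).2 l) /
      ((1 + tA (C i).1.1 y) * sv (C i).1.1 y) * \sum_i' sv (C i').1.1 y)).
  rewrite -(pC_marg i j l (fun v x u => 4 * tgt v x u)).
  rewrite -(pC_marg i j l (fun v x u => tgt v x u / (1 + tC v x u z))).
  rewrite -!sumrB -big_split -!sumrB; apply: eq_bigr => C _ /=.
  by rewrite /tangent /tgt /=; ring.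
have B_gt0 v u : 0 < 1 + tB v u y by rewrite ltr_pwDl // tB_ge0.
have A_gt0 v : 0 < 1 + tA v y by rewrite ltr_pwDl // tA_ge0.
have C_gt0 v x u : 0 < 1 + tC v x u z by rewrite ltr_pwDl // tC_ge0.
have L_neq0 : L != 0 by rewrite pnatr_eq0.
have t0 v x u : 0 <= tgt v x u by exact: target_ge0.
have hB : \sum_(C : codebook) pC C * (tgt (C i).1.1 ((C i).1.2 j) ((C i).2 l) /
      ((1 + tB (C i).1.1 ((C i).2 l) y) * (L * sv (C i).1.1 y)) *
      \sum_l' wu (C i).1.1 ((C i).2 l') y) <= avg3 tgt.
  have := @mean_wu i j l (fun v x u => tgt v x u /
    ((1 + tB v u y) * (L * sv v y))).
  move=> /(_ _ y) /le_trans; apply.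
    by move=> v x u; rewrite divr_ge0 // !mulr_ge0 ?sv_ge0 // ltW.
  apply: avg3_le => v x u; apply: ler_wpM2l; first exact: p3_ge0.
  have [s_eq0|sn0] := eqVneq (sv v y) 0; first by rewrite s_eq0 !mulr0 invr0 mulr0 mul0r.
  have -> : wu v u y + L * sv v y = (1 + tB v u y) * (L * sv v y).
    by rewrite /tB; field; rewrite nat1r sn0 L_neq0.
  by apply: le_of_eq; apply: divfK; rewrite !mulf_neq0 // lt0r_neq0.
have hA : \sum_(C : codebook) pC C * (tgt (C i).1.1 ((C i).1.2 j) ((C i).2 l) /
      ((1 + tA (C i).1.1 y) * sv (C i).1.1 y) * \sum_i' sv (C i').1.1 y)
      <= avg3 tgt.
  have := @mean_sv i j l (fun v x u => tgt v x u / ((1 + tA v y) * sv v y)).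
  move=> /(_ _ y) /le_trans; apply.
    by move=> v x u; rewrite divr_ge0 // !mulr_ge0 ?sv_ge0 // ltW.
  apply: avg3_le => v x u; apply: ler_wpM2l; first exact: p3_ge0.
  have [s_eq0|sn0] := eqVneq (sv v y) 0; first by rewrite s_eq0 !mulr0 invr0 mulr0 mul0r.
  have -> : sv v y + a%:R * s0 y = (1 + tA v y) * sv v y.
    by rewrite /tA; field; rewrite sn0.
  by apply: le_of_eq; apply: divfK; rewrite !mulf_neq0 // lt0r_neq0.
have hC : avg3 (fun v x u => tgt v x u / (1 + tC v x u z)) +
     \sum_(C : codebook) pC C * (tgt (C i).1.1 ((C i).1.2 j) ((C i).2 l) /
      ((1 + tC (C i).1.1 ((C i).1.2 j) ((C i).2 l) z) *
       qd (C i).1.1 ((C i).1.2 j) ((C i).2 l) z) * wrong_weight i j C z) <= avg3 tgt.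
  apply: (@le_trans _ _ (avg3 (fun v x u => tgt v x u / (1 + tC v x u z)) +
    avg3 (fun v x u => tgt v x u / ((1 + tC v x u z) * qd v x u z) *
      (b%:R * q1 v u z + b%:R * L * q2 v z + a%:R * b.+1%:R * L * q3 z)))).
    rewrite lerD2l; apply: (@mean_wrong i j l (fun v x u => tgt v x u /
      ((1 + tC v x u z) * qd v x u z))) => v x u.
    by rewrite divr_ge0 // !mulr_ge0 ?qd_ge0 // ltW.
  apply: le_of_eq; rewrite /avg3 -big_split; apply: eq_bigr => v _ /=.
  rewrite -big_split; apply: eq_bigr => x _ /=.
  rewrite -big_split; apply: eq_bigr => u _ /=.
  rewrite -mulrDr; congr (_ * _).
  rewrite invfM mulrA -mulrA [_^-1 * (_ + _ + _)]mulrC -/(tC v x u z).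
  by field; rewrite lt0r_neq0.
have h4 : avg3 (fun v x u => 4 * tgt v x u) = 4 * avg3 tgt.
  rewrite /avg3 !mulr_sumr; apply: eq_bigr => v _.
  rewrite !mulr_sumr; apply: eq_bigr => x _; rewrite !mulr_sumr.
  by apply: eq_bigr => u _; rewrite mulrCA.
by rewrite split_sum h4 -/tgt; lra.
Qed.

(** Summing [target] over the L indices l turns the factor [tB] of its numerator into wu/sv, the
    change of measure from independent codewords to the joint law. *)
Lemma mean_succ i j :
  \sum_y \sum_z \sum_v \sum_x \sum_u joint_of S v x y u z /
    ((1 + tA v y) * (1 + tB v u y) * (1 + tC v x u z)) <=
  \sum_(C : codebook) pC C * success C i j.
Proof.
apply: (@le_trans _ _ (\sum_y \sum_z \sum_l
    \sum_(C : codebook) pC C * tangent C i j l y z)); last first.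
  under [leRHS]eq_bigr => C _ do rewrite mulr_sumr.
  rewrite [leRHS]exchange_big; apply: ler_sum => y _ /=.
  under [leRHS]eq_bigr => C _ do rewrite mulr_sumr.
  rewrite [leRHS]exchange_big; apply: ler_sum => z _ /=.
  rewrite exchange_big; apply: ler_sum => C _ /=.
  rewrite -mulr_sumr.
  have [->|pC0] := eqVneq (pC C) 0; first by rewrite !mul0r.
  apply: ler_wpM2l; first by apply: prodr_ge0 => *; exact: pK_ge0.
  rewrite -(pair_bigA _ (fun k l => W2 ((C i).1.2 j) y * relay_law C y (k, l) *
    W3 ((C i).1.2 j) (x2f ((C k).2 l) (C k).1.1 y) y z * dec_law C z (i, j))).
  (* Only the relay choices with the correct m' are kept; the others contribute nonnegative
     terms. *)
  rewrite /= (bigD1 i) //= -[leLHS]addr0; apply: lerD.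
    by apply: ler_sum => l _; exact: tangent_le.
  by do 2 (apply: sumr_ge0 => ? _); apply: succ_term_ge0.
apply: ler_sum => y _; apply: ler_sum => z _.
apply: (@le_trans _ _ (\sum_(l < c.+1) avg3 (fun v x u => target v x u y z)));
  last by apply: ler_sum => l _; exact: mean_tangent.
rewrite sumr_const card_ord -mulr_natr /avg3 mulr_suml.
apply: le_of_eq; apply: eq_bigr => v _; rewrite mulr_suml; apply: eq_bigr => x _.
rewrite mulr_suml; apply: eq_bigr => u _; rewrite /target /joint_of /=.
set Q := (_ * (1 + tC _ _ _ _))^-1; rewrite /tB invfM.
have : L != 0 by rewrite pnatr_eq0.
by move: L (sv v y)^-1 => K t K0; field.
Qed.

(** * Passage to a deterministic code and its error bound *)

Lemma min1_add (x y : R) : 0 <= x -> 0 <= y ->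
  Num.min 1 (x + y) <= Num.min 1 x + Num.min 1 y.
Proof.
by move=> x0 y0; rewrite !minEle; do ?case: ifP; move=> *; lra.
Qed.

(** Each factor satisfies 1/(1 + t) >= 1 - min(1, t), and (1 - p)(1 - q)(1 - r) >= 1 - p - q - r for
    numbers in [0, 1]. *)
Lemma inv_den_ge (x y z : R) : 0 <= x -> 0 <= y -> 0 <= z ->
  1 - (Num.min 1 x + Num.min 1 y + Num.min 1 z) <=
  ((1 + x) * (1 + y) * (1 + z))^-1.
Proof.
have key (t : R) : 0 <= t -> 1 - Num.min 1 t <= (1 + t)^-1.
  move=> t0; rewrite -[(1 + t)^-1]mul1r ler_pdivlMr ?ltr_pwDl //.
  by rewrite minEle; case: ifP => *; nra.
have m01 (t : R) : 0 <= t -> 0 <= 1 - Num.min 1 t <= 1.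
  by move=> t0; rewrite minEle; case: ifP => *; lra.
move=> x0 y0 z0; rewrite !invfM.
have /andP[x1 x2] := m01 _ x0; have /andP[y1 y2] := m01 _ y0.
have /andP[z1 z2] := m01 _ z0.
apply: (@le_trans _ _ ((1 - Num.min 1 x) * (1 - Num.min 1 y) *
                       (1 - Num.min 1 z))).
  move: (Num.min 1 x) (Num.min 1 y) (Num.min 1 z) x1 x2 y1 y2 z1 z2.
  move=> p q r x1 x2 y1 y2 z1 z2.
  have h : 1 - p - q <= (1 - p) * (1 - q) by nra.
  have h1 : (1 - p) * (1 - q) <= 1 by nra.
  by move: ((1 - p) * (1 - q)) h h1 => m h h1; nra.
by do 2 (apply: ler_pM; rewrite ?mulr_ge0 ?key //).
Qed.

Lemma joint_of_ge0 v x y u z : 0 <= joint_of S v x y u z.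
Proof.
have W2p := W2_ge0 S x y; have W3p := W3_ge0 S x (x2f u v y) y z.
by rewrite !mulr_ge0 ?pV_ge0 ?pX_ge0 ?pUV_ge0 ?invr_ge0 ?wu_ge0 ?sv_ge0.
Qed.

(** The mean success over codebooks is at least one minus the bound; the codebook, then the relay,
    then the receiver are fixed without lowering it. The injection [phi] into the pairs (m', m'')
    serves numbers of messages that do not factor. *)
Theorem one_shot M (phi : 'I_M -> 'I_a.+1 * 'I_b.+1) :
  injective phi -> (0 < M)%N ->
  exists (enc : 'I_M -> X1) (relay : Y2 -> X2) (dec : Y3 -> option 'I_M),
  M%:R^-1 * \sum_m \sum_y W2 (enc m) y *
    \sum_z W3 (enc m) (relay y) y z * (dec z != Some m)%:R <=
  \sum_y \sum_z \sum_v \sum_x \sum_u joint_of S v x y u z *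
    (Num.min 1 (a%:R * (s0 y / sv v y)) +
     Num.min 1 (L^-1 * (wu v u y / sv v y)) +
     (Num.min 1 (b%:R * (q1 v u z / qd v x u z)) +
      Num.min 1 (b%:R * L * (q2 v z / qd v x u z)) +
      Num.min 1 (a%:R * b.+1%:R * L * (q3 z / qd v x u z)))).
Proof.
move=> phi_inj M0; set m0 := Ordinal M0.
have Mn0 : M%:R != 0 :> R by rewrite pnatr_eq0 -lt0n.
set err := \sum_y \sum_z _.
have pC_ge0 C : 0 <= pC C by apply: prodr_ge0 => *; exact: pK_ge0.
have pC1 : \sum_C pC C = 1.
  by apply: (sum_prod1 (p := fun _ : 'I_a.+1 => pK)) => _; exact: pK_sum.
have [C hC] : exists C, 1 - err <=
    M%:R^-1 * \sum_m success C (phi m).1 (phi m).2.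
  apply: (exists_ge_average pC_ge0 pC1).
  have -> : \sum_C pC C * (M%:R^-1 * \sum_m success C (phi m).1 (phi m).2) =
      M%:R^-1 * \sum_m \sum_C pC C * success C (phi m).1 (phi m).2.
    rewrite exchange_big mulr_sumr; apply: eq_bigr => C _ /=.
    by rewrite -mulr_sumr mulrCA.
  rewrite mulrC ler_pdivlMr ?ltr0n // mulr_natr.
  rewrite -[X in _ *+ X]card_ord -sumr_const; apply: ler_sum => m _.
  apply: le_trans (mean_succ _ _).
  rewrite -[X in X - err](joint_sum S) /err.
  rewrite -sumrB; apply: ler_sum => y _; rewrite -sumrB; apply: ler_sum => z _.
  rewrite -sumrB; apply: ler_sum => v _; rewrite -sumrB; apply: ler_sum => x _.
  rewrite -sumrB; apply: ler_sum => u _.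
  rewrite -[X in X - _]mulr1 -mulrBr; apply: ler_wpM2l; first exact: joint_of_ge0.
  apply: le_trans (inv_den_ge (tA_ge0 _ _) (tB_ge0 _ _ _) (tC_ge0 _ _ _ _)).
  rewrite lerB // !lerD //.
  - by rewrite /tA mulrA.
  - by rewrite /tB [wu v u y / (_ * _)]mulrC invfM -mulrA [_^-1 * wu _ _ _]mulrC.
  rewrite /tC !mulrDl !mulrA.
  have ds (t : R) : 0 <= t -> 0 <= t / qd v x u z.
    by move=> ?; rewrite divr_ge0 ?qd_ge0.
  apply: le_trans (min1_add _ _) _; last (rewrite lerD2r; apply: min1_add);
    rewrite ?addr_ge0 ?ds // !mulr_ge0 ?q1_ge0 ?q2_ge0 ?q3_ge0 //.
pose enc m := (C (phi m).1).1.2 (phi m).2.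
(* [hr y kl] is the success obtained at [y] when the relay picks [kl]. Success is linear in the
   relay law, so the best pick for each [y] does at least as well. *)
pose hr y (kl : 'I_a.+1 * 'I_c.+1) : R := M%:R^-1 * \sum_m \sum_z W2 (enc m) y *
  W3 (enc m) (x2f ((C kl.1).2 kl.2) (C kl.1).1.1 y) y z * dec_law C z (phi m).
have Mi0 : 0 <= M%:R^-1 :> R by rewrite invr_ge0.
have W2p := W2_ge0 S; have W3p := W3_ge0 S.
have hr0 y kl : 0 <= hr y kl.
  apply: mulr_ge0 => //; do 2 (apply: sumr_ge0 => ? _).
  by apply: mulr_ge0; [apply: mulr_ge0|apply: dec_law_ge0].
have [f hf] := substochastic_le_deterministic (ord0, ord0)
  (relay_law_ge0 C) (relay_law_sum C) hr0.
pose relay y := x2f ((C (f y).1).2 (f y).2) (C (f y).1).1.1 y.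
pose gd z m : R := M%:R^-1 * \sum_y W2 (enc m) y * W3 (enc m) (relay y) y z.
have gd0 z m : 0 <= gd z m.
  by apply: mulr_ge0 => //; apply: sumr_ge0 => ? _; apply: mulr_ge0.
(* The receiver law may charge pairs that carry no message, so only a total at most one is left on
   the messages. *)
have dl z : \sum_m dec_law C z (phi m) <= 1.
  apply: le_trans (dec_law_sum C z).
  have -> : \sum_m dec_law C z (phi m) =
      \sum_(p in (phi @: 'I_M)) dec_law C z p.
    by rewrite big_imset //=; apply: in2W.
  rewrite [leRHS](bigID (mem (phi @: 'I_M))) /= lerDl.
  by apply: sumr_ge0 => ? _; exact: dec_law_ge0.
have [d hd] := substochastic_le_deterministic m0
  (fun z m => dec_law_ge0 C z (phi m)) dl gd0.
exists enc, relay, (fun z => Some (d z)).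
have hs : 1 - err <= \sum_z gd z (d z).
  apply: le_trans hC (le_trans _ hd).
  have -> : M%:R^-1 * \sum_m success C (phi m).1 (phi m).2 =
     \sum_y \sum_kl relay_law C y kl * hr y kl.
    rewrite /success exchange_big /= mulr_sumr; apply: eq_bigr => y _.
    under [RHS]eq_bigr => kl _ do rewrite mulrCA mulr_sumr.
    rewrite -mulr_sumr; congr (_ * _).
    rewrite [RHS]exchange_big /=; apply: eq_bigr => m _ /=.
    under [RHS]eq_bigr => kl _ do rewrite mulr_sumr.
    rewrite exchange_big; apply: eq_bigr => kl _ /=; apply: eq_bigr => z _.
    by rewrite -surjective_pairing -/(enc m); ring.
  apply: le_trans hf _; apply: le_of_eq.
  rewrite /hr -mulr_sumr.
  under [RHS]eq_bigr => z _ do under eq_bigr => m _ do rewrite mulrCA mulr_sumr.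
  under [RHS]eq_bigr => z _ do rewrite -mulr_sumr.
  rewrite -mulr_sumr; congr (_ * _).
  under [RHS]eq_bigr => z _ do rewrite exchange_big.
  rewrite [RHS]exchange_big /=; apply: eq_bigr => y _.
  rewrite [RHS]exchange_big /=; apply: eq_bigr => m _.
  by apply: eq_bigr => z _; rewrite mulrC.
(* Error and success are complementary because both channel laws have total mass one. *)
suff -> : M%:R^-1 * \sum_m \sum_y W2 (enc m) y *
    \sum_z W3 (enc m) (relay y) y z * (Some (d z) != Some m)%:R =
    1 - \sum_z gd z (d z) by lra.
have one m : \sum_y W2 (enc m) y * \sum_z W3 (enc m) (relay y) y z = 1.
  by under eq_bigr => y _ do rewrite (W3_sum S) mulr1; rewrite (W2_sum S).
have one_avg : M%:R^-1 * \sum_m \sum_y W2 (enc m) y *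
    \sum_z W3 (enc m) (relay y) y z = 1.
  under eq_bigr => m _ do rewrite one.
  by rewrite sumr_const card_ord mulVf.
have -> : \sum_z gd z (d z) = M%:R^-1 * \sum_m \sum_y W2 (enc m) y *
    \sum_z W3 (enc m) (relay y) y z * (d z == m)%:R.
  rewrite /gd -mulr_sumr; congr (_ * _).
  under [RHS]eq_bigr => m _ do under eq_bigr => y _ do rewrite mulr_sumr.
  under [RHS]eq_bigr => m _ do rewrite exchange_big.
  rewrite [RHS]exchange_big /=; apply: eq_bigr => z _.
  rewrite (bigD1 (d z)) //= [X in _ + X]big1 ?addr0.
    by apply: eq_bigr => y _; rewrite eqxx mulr1.
  move=> m; rewrite eq_sym => /negPf ->; apply: big1 => y _.
  by rewrite !mulr0.
rewrite -[X in _ = X - _]one_avg -mulrBr -sumrB; congr (_ * _).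
apply: eq_bigr => m _.
rewrite -sumrB; apply: eq_bigr => y _; rewrite -mulrBr -sumrB; congr (_ * _).
apply: eq_bigr => z _; rewrite (inj_eq Some_inj).
by case: (d z == m); rewrite /= ?mulr0 ?mulr1 ?subrr ?subr0.
Qed.

End OneShot.

(** * Memoryless extensions *)

Section SchemePower.
Variables (R : realFieldType) (X1 X2 Y2 Y3 V U : finType).
Variables (W2 : X1 -> Y2 -> R) (W3 : X1 -> X2 -> Y2 -> Y3 -> R).
Variable x2f : U -> V -> Y2 -> X2.
Variable S : scheme W2 W3 x2f.
Variable n : nat.
Local Notation vec T := {ffun 'I_n -> T}.

Definition W2_pow (x : vec X1) (y : vec Y2) : R := \prod_i W2 (x i) (y i).
Definition W3_pow (x : vec X1) (x2 : vec X2) (y : vec Y2) (z : vec Y3) : R :=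
  \prod_i W3 (x i) (x2 i) (y i) (z i).
Definition x2f_pow (u : vec U) (v : vec V) (y : vec Y2) : vec X2 :=
  [ffun i => x2f (u i) (v i) (y i)].

Lemma sum_prod_le (J : finType) (F : 'I_n -> J -> R) (g : 'I_n -> R) :
  (forall i j, 0 <= F i j) -> (forall i, \sum_j F i j <= g i) ->
  \sum_(f : {ffun 'I_n -> J}) \prod_i F i (f i) <= \prod_i g i.
Proof.
move=> F0 Fg; rewrite -(bigA_distr_bigA F); apply: ler_prod => i _.
by rewrite sumr_ge0 //= Fg.
Qed.

Lemma sum5_prod (g : Y2 -> Y3 -> V -> X1 -> U -> R) :
  \sum_(y : vec Y2) \sum_(z : vec Y3) \sum_(v : vec V) \sum_(x : vec X1)
    \sum_(u : vec U) \prod_i g (y i) (z i) (v i) (x i) (u i) =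
  (\sum_y \sum_z \sum_v \sum_x \sum_u g y z v x u) ^+ n.
Proof.
rewrite -[in RHS](card_ord n) -prodr_const.
rewrite (bigA_distr_bigA (fun _ y => \sum_z \sum_v \sum_x \sum_u g y z v x u)).
apply: eq_bigr => y _.
rewrite (bigA_distr_bigA (fun i z => \sum_v \sum_x \sum_u g (y i) z v x u)).
apply: eq_bigr => z _.
rewrite (bigA_distr_bigA (fun i v => \sum_x \sum_u g (y i) (z i) v x u)).
apply: eq_bigr => v _.
rewrite (bigA_distr_bigA (fun i x => \sum_u g (y i) (z i) (v i) x u)).
apply: eq_bigr => x _.
by rewrite (bigA_distr_bigA (fun i u => g (y i) (z i) (v i) (x i) u)).
Qed.

(** Expanded form of [joint_of] for the product scheme, convertible to it; it is the form that
    factorizes over letters. *)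
Definition joint_pow (v : vec V) (x : vec X1) (y : vec Y2) (u : vec U)
    (z : vec Y3) : R :=
  (\prod_i pV S (v i)) * (\prod_i pX S (v i) (x i)) * W2_pow x y *
  (\prod_i pUV S (v i) (u i)) *
  ((\prod_i wu S (v i) (u i) (y i)) / (\prod_i sv S (v i) (y i))) *
  W3_pow x (x2f_pow u v y) y z.

Lemma joint_powE v x y u z : joint_pow v x y u z =
  \prod_i joint_of S (v i) (x i) (y i) (u i) (z i).
Proof.
rewrite /joint_pow -prodfV -!big_split /=; apply: eq_bigr => i _.
by rewrite ffunE.
Qed.

(** Sums of products become products of sums, and inequalities between nonnegative factors multiply.
    The definition is transparent because its fields are unfolded later. *)
Definition scheme_pow : scheme W2_pow W3_pow x2f_pow.
Proof.
refine (@Scheme R (vec X1) (vec X2) (vec Y2) (vec Y3) (vec V) (vec U)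
  W2_pow W3_pow x2f_pow
  (fun v => \prod_i pV S (v i)) (fun v x => \prod_i pX S (v i) (x i))
  (fun v u => \prod_i pUV S (v i) (u i)) (fun y => \prod_i s0 S (y i))
  (fun v y => \prod_i sv S (v i) (y i))
  (fun v u y => \prod_i wu S (v i) (u i) (y i))
  (fun v x u z => \prod_i qd S (v i) (x i) (u i) (z i))
  (fun v u z => \prod_i q1 S (v i) (u i) (z i))
  (fun v z => \prod_i q2 S (v i) (z i)) (fun z => \prod_i q3 S (z i))
  _ _ _ _ _ _ _ _ _ _ _ _ _ _ _ _ _ _ _ _).
- by move=> x y; apply: prodr_ge0 => i _; apply: (W2_ge0 S).
- by move=> x; apply: (@sum_prod1 _ _ _ (fun i => W2 (x i))) => i;
    apply: (W2_sum S).
- by move=> x x2 y z; apply: prodr_ge0 => i _; apply: (W3_ge0 S).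
- by move=> x x2 y; apply: (@sum_prod1 _ _ _ (fun i => W3 (x i) (x2 i) (y i))) => i;
    apply: (W3_sum S).
- by move=> v; apply: prodr_ge0 => i _; apply: pV_ge0.
- by apply: (@sum_prod1 _ _ _ (fun _ => pV S)) => i; apply: pV_sum.
- by move=> v x; apply: prodr_ge0 => i _; apply: pX_ge0.
- by move=> v; apply: (@sum_prod1 _ _ _ (fun i => pX S (v i))) => i; apply: pX_sum.
- by move=> v u; apply: prodr_ge0 => i _; apply: pUV_ge0.
- by move=> v; apply: (@sum_prod1 _ _ _ (fun i => pUV S (v i))) => i;
    apply: pUV_sum.
- by move=> v y; apply: prodr_ge0 => i _; apply: sv_ge0.
- by move=> v u y; apply: prodr_ge0 => i _; apply: wu_ge0.
- by move=> v x u z; apply: prodr_ge0 => i _; apply: qd_ge0.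
- move=> y /=; under eq_bigr do rewrite -big_split.
  apply: (sum_prod_le (F := fun i v => pV S v * sv S v (y i))) => i *.
    by rewrite mulr_ge0 ?pV_ge0 ?sv_ge0.
  exact: sv_avg.
- move=> v y /=; under eq_bigr do rewrite -big_split.
  apply: (sum_prod_le (F := fun i u => pUV S (v i) u * wu S (v i) u (y i))) => i *.
    by rewrite mulr_ge0 ?pUV_ge0 ?wu_ge0.
  exact: wu_avg.
- move=> v u z /=; under eq_bigr do rewrite -big_split.
  apply: (sum_prod_le (F := fun i x => pX S (v i) x * qd S (v i) x (u i) (z i)))
    => i *; first by rewrite mulr_ge0 ?pX_ge0 ?qd_ge0.
  exact: qd_avg1.
- move=> v z /=; under eq_bigr => x _ do under eq_bigr do rewrite -!big_split /=.
  under eq_bigr => x _ do rewrite -(bigA_distr_bigA (fun i u =>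
    pX S (v i) (x i) * pUV S (v i) u * qd S (v i) (x i) u (z i))).
  apply: (sum_prod_le (F := fun i x => \sum_u
    pX S (v i) x * pUV S (v i) u * qd S (v i) x u (z i))) => i *.
    by apply: sumr_ge0 => *; rewrite !mulr_ge0 ?pX_ge0 ?pUV_ge0 ?qd_ge0.
  exact: qd_avg2.
- move=> z /=; under eq_bigr => v _ do under eq_bigr => x _ do
    under eq_bigr do rewrite -!big_split /=.
  under eq_bigr => v _ do under eq_bigr => x _ do
    rewrite -(bigA_distr_bigA (fun i u => pV S (v i) *
    pX S (v i) (x i) * pUV S (v i) u * qd S (v i) (x i) u (z i))).
  under eq_bigr => v _ do rewrite -(bigA_distr_bigA (fun i x => \sum_u
    pV S (v i) * pX S (v i) x * pUV S (v i) u * qd S (v i) x u (z i))).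
  apply: (sum_prod_le (F := fun i v => \sum_x \sum_u pV S v *
    pX S v x * pUV S v u * qd S v x u (z i))) => i *.
    do 2 (apply: sumr_ge0 => ? _).
    by rewrite !mulr_ge0 ?pV_ge0 ?pX_ge0 ?pUV_ge0 ?qd_ge0.
  exact: qd_avg3.
- move=> v x y u z; rewrite -/(joint_pow v x y u z) joint_powE.
  move=> /prodf_neq0 jn0; apply/prodf_neq0 => i _.
  exact: (joint_qd (jn0 i isT)).
- rewrite -[RHS](expr1n _ n) -[X in _ = X ^+ n](joint_sum S) -sum5_prod.
  apply: eq_bigr => y _; apply: eq_bigr => z _; apply: eq_bigr => v _.
  apply: eq_bigr => x _; apply: eq_bigr => u _.
  by rewrite -/(joint_pow v x y u z) joint_powE.
Defined.

End SchemePower.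

(** * Exponential moments of a variable with negative mean *)

Section ExponentialDecay.
Variable R : realType.

(** From exp(-x) >= 1 - x one gets exp(x) <= 1/(1 - x), and (1 + x + 2x^2)(1 - x) = 1 + x^2 (1 - 2x)
    >= 1. *)
Lemma expR_le_quad (x : R) : `|x| <= 2^-1 -> expR x <= 1 + x + 2 * x ^+ 2.
Proof.
rewrite ler_norml => /andP[x1 x2].
have d0 : 0 < 1 - x by lra.
have : 1 - x <= expR (- x) by have := expR_ge1Dx (- x).
rewrite expRN -[X in _ <= X]mul1r ler_pdivlMr ?expR_gt0 // => h.
have {}h : expR x <= (1 - x)^-1.
  by rewrite -[X in _ <= X]mul1r ler_pdivlMr // mulrC.
apply: le_trans h _; rewrite -[X in X <= _]mul1r ler_pdivrMr //.
have := sqr_ge0 x; rewrite expr2 => xx0.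
have -> : (1 + x + 2 * (x * x)) * (1 - x) = 1 + x * x * (1 - 2 * x) by ring.
by rewrite lerDl mulr_ge0 //; lra.
Qed.

(** Chernoff argument: the moment is 1 + s mu up to a quadratic error, and the linear term wins for
    small s. *)
Lemma exp_moment_lt1 (T : finType) (P a : T -> R) :
  (forall t, 0 <= P t) -> \sum_t P t = 1 -> \sum_t P t * a t < 0 ->
  exists s : R, [/\ 0 <= s, s <= 1 & \sum_t P t * expR (s * a t) < 1].
Proof.
move=> P0 P1; set mu := \sum_t _ => mu0.
pose A := 1 + \sum_t `|a t|.
have A1 : 1 <= A by rewrite lerDl sumr_ge0.
have aA t : `|a t| <= A.
  rewrite /A (bigD1 t) //= addrCA lerDl addr_ge0 //.
  by rewrite sumr_ge0.
have muA : - mu <= A.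
  rewrite -sumrN -[A]mul1r -P1 mulr_suml; apply: ler_sum => t _.
  rewrite -mulrN ler_wpM2l // (le_trans _ (aA t)) //.
  by rewrite -normrN ler_norm.
have A0 : 0 < A by lra.
(* Minimizer of s mu + 2 (sA)^2. It gives s mu = -4 (sA)^2, twice the quadratic error in size, and
   sA <= 1/4 stays in the range of the quadratic bound. *)
pose s := - mu / (4 * A ^+ 2).
have A20 : 0 < 4 * A ^+ 2 by rewrite mulr_gt0 // exprn_gt0.
have s0 : 0 <= s by rewrite divr_ge0 //; lra.
have sA : s * A <= 4^-1.
  rewrite /s mulrAC ler_pdivrMr //.
  have -> : 4^-1 * (4 * A ^+ 2) = A * A by rewrite mulrA mulVf ?mul1r // expr2.
  by apply: ler_wpM2r => //; lra.
exists s; split=> //; first by nra.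
have E : s * mu = - 4 * (s * A) ^+ 2.
  by rewrite /s; field; rewrite lt0r_neq0.
have s_gt0 : 0 < s by rewrite divr_gt0 //; lra.
apply: (@le_lt_trans _ _ (\sum_t P t * (1 + s * a t + 2 * (s * A) ^+ 2))).
  apply: ler_sum => t _; apply: ler_wpM2l => //.
  have sa : `|s * a t| <= s * A.
    by rewrite normrM ger0_norm //; apply: ler_wpM2l.
  apply: le_trans (expR_le_quad _) _; first by lra.
  rewrite lerD2l ler_wpM2l //; move: sa; rewrite ler_norml => /andP[sa1 sa2].
  by rewrite -subr_ge0 subr_sqr mulr_ge0; lra.
have -> : \sum_t P t * (1 + s * a t + 2 * (s * A) ^+ 2) =
    1 + s * mu + 2 * (s * A) ^+ 2.
  rewrite /mu mulr_sumr -[X in _ = X + _ + _]P1 -[X in _ = _ + X]mul1r.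
  rewrite -[X in _ = _ + X * _]P1 mulr_suml -!big_split.
  by apply: eq_bigr => t _ /=; ring.
have : 0 < (s * A) ^+ 2 by rewrite exprn_gt0 // mulr_gt0.
by rewrite E; lra.
Qed.

Lemma min1_expR_le (s x : R) : 0 <= s <= 1 ->
  Num.min 1 (expR x) <= expR (s * x).
Proof.
move=> /andP[s0 s1]; rewrite ge_min; have [x0|x0] := leP 0 x.
  by rewrite -[X in X <= _]expR0 ler_expR mulr_ge0.
by apply/orP; right; rewrite ler_expR; nra.
Qed.

End ExponentialDecay.

(** * Decay of the n-letter error terms *)

Section Asymptotics.
Variables (R : realType) (X1 X2 Y2 Y3 V U : finType).
Variables (W2 : X1 -> Y2 -> R) (W3 : X1 -> X2 -> Y2 -> Y3 -> R).
Variable x2f : U -> V -> Y2 -> X2.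
Variable S : scheme W2 W3 x2f.

Definition mean5 (g : V -> X1 -> Y2 -> U -> Y3 -> R) : R :=
  \sum_y \sum_z \sum_v \sum_x \sum_u joint_of S v x y u z * g v x y u z.

Lemma sum5_pair (g : V -> X1 -> Y2 -> U -> Y3 -> R) :
  \sum_y \sum_z \sum_v \sum_x \sum_u g v x y u z =
  \sum_(t : Y2 * Y3 * V * X1 * U)
    g t.1.1.2 t.1.2 t.1.1.1.1 t.2 t.1.1.1.2.
Proof. by rewrite !pair_bigA. Qed.

(** Common form of the five error terms: [r] is a single-letter likelihood ratio and [K] a number of
    competitors, or the inverse of the list size. *)
Definition vec_mean n (K : R) (r : V -> X1 -> Y2 -> U -> Y3 -> R) : R :=
  \sum_y \sum_z \sum_v \sum_x \sum_u joint_of (scheme_pow S n) v x y u z *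
    Num.min 1 (K * \prod_i r (v i) (x i) (y i) (u i) (z i)).

(** After min(1, t) <= t^s the mean factorizes into the n-th power of the exponential moment of ln r
    + rho, which is below one for a suitable s. The constant [k] absorbs the rounding of the
    counts. *)
Lemma vec_mean_decay (r : V -> X1 -> Y2 -> U -> Y3 -> R) (rho k : R)
    (K : nat -> R) :
  (forall v x y u z, joint_of S v x y u z != 0 -> 0 < r v x y u z) ->
  mean5 (fun v x y u z => ln (r v x y u z)) + rho < 0 ->
  1 <= k -> (forall n, 0 <= K n <= k * expR (n%:R * rho)) ->
  exists2 q : R, 0 <= q < 1 & forall n, vec_mean n (K n) r <= k * q ^+ n.
Proof.
move=> r0 neg k1 hK.
pose P (t : Y2 * Y3 * V * X1 * U) : R :=
  joint_of S t.1.1.2 t.1.2 t.1.1.1.1 t.2 t.1.1.1.2.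
pose a (t : Y2 * Y3 * V * X1 * U) : R :=
  ln (r t.1.1.2 t.1.2 t.1.1.1.1 t.2 t.1.1.1.2) + rho.
have P0 t : 0 <= P t by apply: joint_of_ge0.
have P1 : \sum_t P t = 1 by rewrite -[RHS](joint_sum S) sum5_pair.
have Pa : \sum_t P t * a t < 0.
  move: neg; rewrite /mean5 sum5_pair -[X in _ + X]mul1r -P1 mulr_suml.
  rewrite -big_split /=.
  by under eq_bigr do rewrite -mulrDr.
have [s [s0 s1 lt1]] := exp_moment_lt1 P0 P1 Pa.
exists (\sum_t P t * expR (s * a t)).
  by rewrite lt1 andbT sumr_ge0 // => t _; rewrite mulr_ge0 // expR_ge0.
move=> n.
have -> : \sum_t P t * expR (s * a t) =
  \sum_y \sum_z \sum_v \sum_x \sum_u joint_of S v x y u z *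
     expR (s * (ln (r v x y u z) + rho)) by rewrite sum5_pair.
rewrite -(sum5_prod n (fun y z v x u => joint_of S v x y u z *
     expR (s * (ln (r v x y u z) + rho)))).
rewrite mulr_sumr; apply: ler_sum => y _.
rewrite mulr_sumr; apply: ler_sum => z _.
rewrite mulr_sumr; apply: ler_sum => v _.
rewrite mulr_sumr; apply: ler_sum => x _.
rewrite mulr_sumr; apply: ler_sum => u _.
rewrite -[joint_of _ _ _ _ _ _]/(joint_pow S v x y u z) joint_powE.
rewrite [in X in _ <= X]big_split [X in _ <= X]mulrCA /=.
set J := \prod_i joint_of _ _ _ _ _ _.
have J0 : 0 <= J by apply: prodr_ge0 => i _; apply: joint_of_ge0.
have [->|Jn0] := eqVneq J 0; first by rewrite !mul0r.
apply: ler_wpM2l => //.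
have ri i : 0 < r (v i) (x i) (y i) (u i) (z i).
  by apply: r0; move/prodf_neq0: Jn0; apply.
pose T := \sum_i (ln (r (v i) (x i) (y i) (u i) (z i)) + rho).
rewrite -expR_sum -mulr_sumr -/T.
have k0 : 0 <= k by lra.
have hT : K n * \prod_i r (v i) (x i) (y i) (u i) (z i) <= k * expR T.
  have -> : T = n%:R * rho + \sum_i ln (r (v i) (x i) (y i) (u i) (z i)).
    by rewrite /T big_split /= sumr_const card_ord mulr_natl addrC.
  rewrite expRD expR_sum mulrA; have /andP[K0 Kk] := hK n.
  apply: ler_pM => //; first by apply: prodr_ge0 => i _; apply: ltW.
  by apply: ler_prod => i _; rewrite lnK ?posrE // ltW //=.
(* Since k >= 1, min(1, k e^T) <= k min(1, e^T), which frees the minimum of the constant. *)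
apply: (@le_trans _ _ (k * Num.min 1 (expR T))).
  rewrite minr_pMr // mulr1 le_min.
  by apply/andP; split; rewrite ge_min ?k1 ?hT ?orbT.
by apply: ler_wpM2l => //; apply: min1_expR_le; rewrite s0.
Qed.

Lemma vec_mean_ge0 n K r : 0 <= K ->
  (forall v x y u z, 0 <= r v x y u z) -> 0 <= vec_mean n K r.
Proof.
move=> K0 r0; do 5 (apply: sumr_ge0 => ? _).
rewrite mulr_ge0 //; last by rewrite le_min ler01 mulr_ge0 // prodr_ge0.
rewrite -[joint_of _ _ _ _ _ _]/(joint_pow S _ _ _ _ _) joint_powE.
by apply: prodr_ge0 => i _; apply: joint_of_ge0.
Qed.

End Asymptotics.

Section MeanTheory.
Variables (R : realType) (X1 X2 Y2 Y3 V U : finType).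
Variables (W2 : X1 -> Y2 -> R) (W3 : X1 -> X2 -> Y2 -> Y3 -> R).
Variable x2f : U -> V -> Y2 -> X2.

Lemma mean5D (T : scheme W2 W3 x2f) f g :
  mean5 T (fun v x y u z => f v x y u z + g v x y u z) = mean5 T f + mean5 T g.
Proof.
rewrite /mean5 -big_split; apply: eq_bigr => y _ /=.
rewrite -big_split; apply: eq_bigr => z _ /=.
rewrite -big_split; apply: eq_bigr => v _ /=.
rewrite -big_split; apply: eq_bigr => x _ /=.
by rewrite -big_split; apply: eq_bigr => u _ /=; rewrite mulrDr.
Qed.

Lemma eq_mean5 (T : scheme W2 W3 x2f) f g :
  (forall v x y u z, joint_of T v x y u z != 0 -> f v x y u z = g v x y u z) ->
  mean5 T f = mean5 T g.
Proof.
move=> fg; do 5 (apply: eq_bigr => ? _).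
set J := joint_of _ _ _ _ _ _.
by have [->|/fg ->] := eqVneq J 0; rewrite ?mul0r.
Qed.

End MeanTheory.

(** * Rate conditions under which a scheme yields codes *)

Section SchemeAchievability.
Variables (R : realType) (X1 X2 Y2 Y3 V U : finType).
Variables (W2 : X1 -> Y2 -> R) (W3 : X1 -> X2 -> Y2 -> Y3 -> R).
Variable x2f : U -> V -> Y2 -> X2.
Variable S : scheme W2 W3 x2f.

(** The five ratios of the one-shot bound in the format of [vec_mean]. Up to sign and the factor ln
    2, their mean logarithms become mutual informations or sums of two of them. *)
Definition ratioA (v : V) (x : X1) (y : Y2) (u : U) (z : Y3) : R :=
  s0 S y / sv S v y.
Definition ratioB (v : V) (x : X1) (y : Y2) (u : U) (z : Y3) : R :=
  wu S v u y / sv S v y.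
Definition ratio1 (v : V) (x : X1) (y : Y2) (u : U) (z : Y3) : R :=
  q1 S v u z / qd S v x u z.
Definition ratio2 (v : V) (x : X1) (y : Y2) (u : U) (z : Y3) : R :=
  q2 S v z / qd S v x u z.
Definition ratio3 (v : V) (x : X1) (y : Y2) (u : U) (z : Y3) : R :=
  q3 S z / qd S v x u z.

Lemma joint_of_neq0 v x y u z : joint_of S v x y u z != 0 ->
  [/\ 0 < pV S v, 0 < pX S v x, 0 < pUV S v u, 0 < sv S v y &
      0 < wu S v u y /\ 0 < qd S v x u z].
Proof.
move=> jn0; have qn0 := joint_qd jn0.
move: jn0; rewrite /joint_of /= !mulf_eq0 invr_eq0 !negb_or.
move=> /andP[/andP[/andP[/andP[/andP[v0 x0] _] u0] /andP[w0 s0]] _].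
by rewrite !lt_def v0 x0 u0 w0 s0 qn0 pV_ge0 pX_ge0 pUV_ge0 sv_ge0 wu_ge0 qd_ge0.
Qed.

Lemma le_sum_term (T : finType) (F : T -> R) t :
  (forall t, 0 <= F t) -> F t <= \sum_t F t.
Proof. by move=> F0; rewrite (bigD1 t) //= lerDl sumr_ge0. Qed.

(** Each numerator bounds an average from above, hence also the term of that average at the given
    point, which is positive on the support of the joint law. *)
Lemma ratios_gt0 v x y u z : joint_of S v x y u z != 0 ->
  [/\ 0 < ratioA v x y u z, 0 < ratioB v x y u z, 0 < ratio1 v x y u z,
      0 < ratio2 v x y u z & 0 < ratio3 v x y u z].
Proof.
move=> /joint_of_neq0[pv px pu s_gt0 [w_gt0 q_gt0]].
have term0 v' x' u' : 0 <= pV S v' * pX S v' x' * pUV S v' u' * qd S v' x' u' z.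
  by rewrite !mulr_ge0 ?pV_ge0 ?pX_ge0 ?pUV_ge0 ?qd_ge0.
rewrite /ratioA /ratioB /ratio1 /ratio2 /ratio3.
split; apply: divr_gt0 => //.
- apply: lt_le_trans (sv_avg S y).
  apply: lt_le_trans (le_sum_term v _); first by rewrite mulr_gt0.
  by move=> t; rewrite mulr_ge0 ?pV_ge0 ?sv_ge0.
- apply: lt_le_trans (qd_avg1 S v u z).
  apply: lt_le_trans (le_sum_term x _); first by rewrite mulr_gt0.
  by move=> t; rewrite mulr_ge0 ?pX_ge0 ?qd_ge0.
- apply: lt_le_trans (qd_avg2 S v z).
  apply: lt_le_trans (le_sum_term x _); last first.
    by move=> t; apply: sumr_ge0 => *; rewrite !mulr_ge0 ?pX_ge0 ?pUV_ge0 ?qd_ge0.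
  apply: lt_le_trans (le_sum_term u _); first by rewrite !mulr_gt0.
  by move=> t; rewrite !mulr_ge0 ?pX_ge0 ?pUV_ge0 ?qd_ge0.
- apply: lt_le_trans (qd_avg3 S z).
  apply: lt_le_trans (le_sum_term v _); last first.
    by move=> t; do 2 (apply: sumr_ge0 => ? _); apply: term0.
  apply: lt_le_trans (le_sum_term x _); last first.
    by move=> t; apply: sumr_ge0 => ? _; apply: term0.
  apply: lt_le_trans (le_sum_term u _); first by rewrite !mulr_gt0.
  by move=> t; apply: term0.
Qed.

Lemma ratios_ge0 v x y u z :
  [/\ 0 <= ratioA v x y u z, 0 <= ratioB v x y u z, 0 <= ratio1 v x y u z,
      0 <= ratio2 v x y u z & 0 <= ratio3 v x y u z].
Proof.
split; rewrite divr_ge0 ?sv_ge0 ?wu_ge0 ?qd_ge0 //;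
by [apply: s0_ge0|apply: q1_ge0|apply: q2_ge0|apply: q3_ge0].
Qed.

Lemma exists_code n M a b c : (M <= a.+1 * b.+1)%N ->
  exists code : relay_code X1 X2 Y2 Y3 n M, err_prob W2 W3 code <=
    vec_mean S n a%:R ratioA + vec_mean S n c.+1%:R^-1 ratioB +
    (vec_mean S n b%:R ratio1 + vec_mean S n (b%:R * c.+1%:R) ratio2 +
     vec_mean S n (a%:R * b.+1%:R * c.+1%:R) ratio3).
Proof.
wlog M0 : M / (0 < M)%N.
  (* No message is left at negative rates and large n. The error is then an empty sum, and the relay
     map is borrowed from a code for one message. *)
  move=> wl MM; case: (posnP M) => [M0|M0]; last exact: wl.
  have [|code _] := wl 1%N isT; first by rewrite muln_gt0.
  have nil : 'I_M -> False by rewrite M0 => -[].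
  exists (@RelayCode X1 X2 Y2 Y3 n M (fun m => False_rect _ (nil m))
    (rc_relay code) (fun _ => None)).
  rewrite /err_prob big1; last by move=> m; case: (nil m).
  rewrite mulr0.
  do ![apply: addr_ge0]; apply: vec_mean_ge0;
    rewrite ?mulr_ge0 ?invr_ge0 // => v x y u z; by case: (ratios_ge0 v x y u z).
move=> MM.
have cM : (M <= #|{: 'I_a.+1 * 'I_b.+1}|)%N by rewrite card_prod !card_ord.
pose phi m := enum_val (widen_ord cM m).
have phi_inj : injective phi.
  by move=> m1 m2 /enum_val_inj /(congr1 val) /= /val_inj.
have [enc [relay [dec le]]] := one_shot (scheme_pow S n) c phi_inj M0.
exists (RelayCode (fun m i => enc m i) (fun i y => relay y i) dec).
apply: le_trans le _.
have vmE K r : vec_mean S n K r = mean5 (scheme_pow S n)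
  (fun v x y u z => Num.min 1 (K * \prod_i r (v i) (x i) (y i) (u i) (z i)))
  by [].
rewrite !vmE -!mean5D; apply: le_of_eq.
apply: eq_mean5 => v x y u z _.
by rewrite /ratioA /ratioB /ratio1 /ratio2 /ratio3 !big_split !prodfV.
Qed.

Lemma vec_mean_cvg0 (r : V -> X1 -> Y2 -> U -> Y3 -> R) (rho k : R)
    (K : nat -> R) :
  (forall v x y u z, joint_of S v x y u z != 0 -> 0 < r v x y u z) ->
  (forall v x y u z, 0 <= r v x y u z) ->
  mean5 S (fun v x y u z => ln (r v x y u z)) + rho < 0 ->
  1 <= k -> (forall n, 0 <= K n <= k * expR (n%:R * rho)) ->
  ((fun n => vec_mean S n (K n) r) @ \oo --> (0 : R))%classic.
Proof.
move=> r_gt0 r_ge0 neg k1 hK.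
have [q /andP[q_ge0 q_lt1] le] := vec_mean_decay r_gt0 neg k1 hK.
apply: (@squeeze_cvgr _ _ _ _ (fun=> 0) (geometric k q)).
- near=> n; rewrite /= le andbT vec_mean_ge0 //.
  by have /andP[] := hK n.
- exact: cvg_cst.
- by apply: cvg_geometric; rewrite ger0_norm.
Unshelve. all: by end_near. Qed.

Lemma vec_mean_0 n r : vec_mean S n 0 r = 0.
Proof.
rewrite /vec_mean; do 5 (apply: big1 => ? _).
by rewrite mul0r minEle ler10 mulr0.
Qed.

(* One less than the number of indices of rate r. It vanishes at rate 0, so that
   no condition is needed on a part of the message that carries nothing. *)
Definition extra_count (r : R) (n : nat) : nat :=
  if r == 0 then 0%N else Num.truncn (2 `^ (n%:R * r)).

(** Converts the base 2 of rates to the natural exponentials of the decay estimates. *)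
Lemma pow2E (x : R) : 2 `^ x = expR (x * ln 2).
Proof. by rewrite /powR pnatr_eq0. Qed.

(** Rounding to integers costs at most a factor 2, which the constants 2 and 4 in the decay
    estimates below absorb. *)
Lemma count_bounds r n : 0 <= r ->
  [/\ (extra_count r n)%:R <= expR (n%:R * (r * ln 2)),
      expR (n%:R * (r * ln 2)) <= (extra_count r n).+1%:R &
      (extra_count r n).+1%:R <= 2 * expR (n%:R * (r * ln 2))].
Proof.
move=> r0; have ln2 : 0 <= ln 2 :> R by rewrite ln_ge0 // ler1n.
have e1 : 1 <= expR (n%:R * (r * ln 2)).
  by rewrite -[X in X <= _]expR0 ler_expR !mulr_ge0.
rewrite /extra_count; have [->|rn0] := eqVneq r 0.
  by rewrite mul0r mulr0 expR0; split=> //; rewrite mulr1 ler_nat.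
rewrite pow2E -mulrA; set e := expR _ in e1 *.
have e0 : 0 <= e by rewrite expR_ge0.
have h1 : (Num.truncn e)%:R <= e by rewrite truncn_le.
have h2 := ltW (truncnS_gt e).
by split=> //; rewrite -natr1; lra.
Qed.

(** [r1], [r2], [rt] are the rates of m', m'' and l. The five conditions control, in order, m' at
    the relay, the list of u, then at the receiver m'' with the true l, m'' with a wrong l, and
    m'. *)
Lemma scheme_achievable (rate r1 r2 rt : R) :
  0 <= r1 -> 0 <= r2 -> 0 <= rt -> rate <= r1 + r2 ->
  (0 < r1 -> mean5 S (fun v x y u z => ln (ratioA v x y u z)) +
    r1 * ln 2 < 0) ->
  mean5 S (fun v x y u z => ln (ratioB v x y u z)) - rt * ln 2 < 0 ->
  (0 < r2 -> mean5 S (fun v x y u z => ln (ratio1 v x y u z)) +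
    r2 * ln 2 < 0) ->
  (0 < r2 -> mean5 S (fun v x y u z => ln (ratio2 v x y u z)) +
    (r2 + rt) * ln 2 < 0) ->
  (0 < r1 -> mean5 S (fun v x y u z => ln (ratio3 v x y u z)) +
    (r1 + r2 + rt) * ln 2 < 0) ->
  achievable W2 W3 rate.
Proof.
move=> r1_ge0 r2_ge0 rt_ge0 rate_le hA hB h1 h2 h3.
have ln2 : 0 <= ln 2 :> R by rewrite ln_ge0 // ler1n.
pose bnd n := vec_mean S n (extra_count r1 n)%:R ratioA +
  vec_mean S n (extra_count rt n).+1%:R^-1 ratioB +
  (vec_mean S n (extra_count r2 n)%:R ratio1 +
   vec_mean S n ((extra_count r2 n)%:R * (extra_count rt n).+1%:R) ratio2 +
   vec_mean S n ((extra_count r1 n)%:R * (extra_count r2 n).+1%:R * (extra_count rt n).+1%:R)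
     ratio3).
have ex n : exists code : relay_code X1 X2 Y2 Y3 n
    (num_msgs rate n), err_prob W2 W3 code <= bnd n.
  apply: exists_code.
  have [_ l1 _] := count_bounds n r1_ge0; have [_ l2 _] := count_bounds n r2_ge0.
  rewrite -(ler_nat R) natrM; apply: le_trans (ler_pM _ _ l1 l2);
    rewrite ?expR_ge0 //.
  apply: (@le_trans _ _ (2 `^ (n%:R * rate))).
    by rewrite truncn_le powR_ge0.
  rewrite pow2E -expRD ler_expR -mulrDr -mulrDl mulrA.
  by apply: ler_wpM2r => //; apply: ler_wpM2l.
pose code n := sval (cid (ex n)).
have hcode n : err_prob W2 W3 (code n) <= bnd n := svalP (cid (ex n)).
exists code.
have gt0 v x y u z := @ratios_gt0 v x y u z.
have err0 n : 0 <= err_prob W2 W3 (code n).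
  rewrite mulr_ge0 ?invr_ge0 //; do 2 (apply: sumr_ge0 => ? _).
  rewrite mulr_ge0 ?prodr_ge0 ?sumr_ge0 // => *; first exact: (W2_ge0 S).
  by rewrite mulr_ge0 // prodr_ge0 // => *; exact: (W3_ge0 S).
apply: (@squeeze_cvgr _ _ _ _ (fun=> 0) bnd).
- by near=> n; rewrite /= err0 hcode.
- exact: cvg_cst.
have cA : ((fun n => vec_mean S n (extra_count r1 n)%:R ratioA) @ \oo --> (0 : R))%classic.
  have [r10|r1n0] := eqVneq r1 0.
    rewrite /extra_count r10 eqxx; under eq_fun do rewrite vec_mean_0.
    exact: cvg_cst.
  apply: (vec_mean_cvg0 _ _ (hA _) (lexx 1)).
  - by move=> v x y u z /gt0[].
  - by move=> v x y u z; case: (ratios_ge0 v x y u z).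
  - by rewrite lt_def r1n0.
  - by move=> n; rewrite ler0n mul1r; case: (count_bounds n r1_ge0).
have cB : ((fun n => vec_mean S n (extra_count rt n).+1%:R^-1 ratioB) @ \oo
    --> (0 : R))%classic.
  apply: (vec_mean_cvg0 _ _ hB (lexx 1)).
  - by move=> v x y u z /gt0[].
  - by move=> v x y u z; case: (ratios_ge0 v x y u z).
  move=> n; rewrite invr_ge0 ler0n mul1r mulrN expRN lef_pV2 ?posrE ?expR_gt0 //.
  by case: (count_bounds n rt_ge0).
have c1 : ((fun n => vec_mean S n (extra_count r2 n)%:R ratio1) @ \oo --> (0 : R))%classic.
  have [r20|r2n0] := eqVneq r2 0.
    rewrite /extra_count r20 eqxx; under eq_fun do rewrite vec_mean_0.
    exact: cvg_cst.
  apply: (vec_mean_cvg0 _ _ (h1 _) (lexx 1)).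
  - by move=> v x y u z /gt0[].
  - by move=> v x y u z; case: (ratios_ge0 v x y u z).
  - by rewrite lt_def r2n0.
  - by move=> n; rewrite ler0n mul1r; case: (count_bounds n r2_ge0).
have c2 : ((fun n => vec_mean S n ((extra_count r2 n)%:R * (extra_count rt n).+1%:R) ratio2)
    @ \oo --> (0 : R))%classic.
  have [r20|r2n0] := eqVneq r2 0.
    rewrite {1}/extra_count r20 eqxx; under eq_fun do rewrite mul0r vec_mean_0.
    exact: cvg_cst.
  apply: (@vec_mean_cvg0 _ _ 2 _ _ _ (h2 _)).
  - by move=> v x y u z /gt0[].
  - by move=> v x y u z; case: (ratios_ge0 v x y u z).
  - by rewrite lt_def r2n0.
  - by rewrite ler1n.
  move=> n; rewrite mulr_ge0 //= [(r2 + rt) * _]mulrDl [n%:R * _]mulrDr expRD.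
  rewrite [X in _ <= X]mulrCA.
  have [a1 _ _] := count_bounds n r2_ge0; have [_ _ a2] := count_bounds n rt_ge0.
  exact: ler_pM.
have c3 : ((fun n => vec_mean S n ((extra_count r1 n)%:R * (extra_count r2 n).+1%:R *
    (extra_count rt n).+1%:R) ratio3) @ \oo --> (0 : R))%classic.
  have [r10|r1n0] := eqVneq r1 0.
    rewrite {1}/extra_count r10 eqxx; under eq_fun do rewrite !mul0r vec_mean_0.
    exact: cvg_cst.
  apply: (@vec_mean_cvg0 _ _ 4 _ _ _ (h3 _)).
  - by move=> v x y u z /gt0[].
  - by move=> v x y u z; case: (ratios_ge0 v x y u z).
  - by rewrite lt_def r1n0.
  - by rewrite ler1n.
  move=> n; rewrite !mulr_ge0 //= [(r1 + r2 + rt) * _]mulrDl.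
  rewrite [(r1 + r2) * _]mulrDl [n%:R * _]mulrDr [n%:R * (_ + _)]mulrDr !expRD.
  have [a1 _ _] := count_bounds n r1_ge0; have [_ _ a2] := count_bounds n r2_ge0.
  have [_ _ a3] := count_bounds n rt_ge0.
  have -> (x y z : R) : 4 * (x * y * z) = x * (2 * y) * (2 * z) by ring.
  by do 2 (apply: ler_pM => //).
have := cvgD (cvgD cA cB) (cvgD (cvgD c1 c2) c3); rewrite !addr0; exact.
Unshelve. all: by end_near. Qed.

End SchemeAchievability.

(** * Single-letter quantities *)

Section InformationDensity.
Variable R : realType.

Definition marg (Om A : finType) (P : Om -> R) (f : Om -> A) (a : A) : R :=
  \sum_(t | f t == a) P t.

(** The ratio p(a,b,c) p(c) / (p(a,c) p(b,c)) at an outcome; its logarithm is the conditional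
    information density. *)
Definition cond_ratio (Om TA TB TC : finType) (P : Om -> R)
    (A : Om -> TA) (B : Om -> TB) (C : Om -> TC) (t : Om) : R :=
  (\sum_(t' | (A t' == A t) && (B t' == B t) && (C t' == C t)) P t') *
  (\sum_(t' | C t' == C t) P t') /
  ((\sum_(t' | (A t' == A t) && (C t' == C t)) P t') *
   (\sum_(t' | (B t' == B t) && (C t' == C t)) P t')).

(** Outcomes are grouped by the values of the three variables; a cell of probability zero
    contributes nothing on either side. *)
Lemma cond_mutinfoE (Om TA TB TC : finType) (P : Om -> R)
    (A : Om -> TA) (B : Om -> TB) (C : Om -> TC) : (forall t, 0 <= P t) ->
  cond_mutinfo P A B C = \sum_t P t * log2 (cond_ratio P A B C t).
Proof.
move=> P0; rewrite /cond_mutinfo (partition_big A xpredT) //=.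
apply: eq_bigr => a _; rewrite (partition_big B xpredT) //=.
apply: eq_bigr => b _; rewrite (partition_big C xpredT) //=.
apply: eq_bigr => c _; set pabc := \sum_(t | _) P t.
set lg := log2 _.
transitivity (\sum_(t | (A t == a) && (B t == b) && (C t == c)) P t * lg).
  rewrite -mulr_suml -/pabc; case: ltP => // le0.
  suff -> : pabc = 0 by rewrite mul0r.
  by apply/eqP; rewrite eq_le le0 sumr_ge0.
apply: eq_bigr => t /andP[/andP[/eqP Ea /eqP Eb] /eqP Ec].
by rewrite /lg /pabc /cond_ratio Ea Eb Ec.
Qed.

Variables (Om : finType) (P : Om -> R).
Hypothesis P0 : forall t, 0 <= P t.

Lemma marg_ge0 (A : finType) (f : Om -> A) a : 0 <= marg P f a.
Proof. exact: sumr_ge0. Qed.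

Lemma marg_ge (A : finType) (f : Om -> A) t : P t <= marg P f (f t).
Proof. by rewrite /marg (bigD1 t) //= lerDl sumr_ge0. Qed.

Lemma marg_id t : marg P id t = P t.
Proof. by rewrite /marg big_pred1_eq. Qed.

(** [k] inserts the summed component among the others, so that one lemma serves all shapes of
    tuples. *)
Lemma sum_marg (A B T : finType) (f : Om -> A) (g : Om -> B) (h : Om -> T)
    (k : B -> T) (a : A) :
  (forall t b, (h t == k b) = (f t == a) && (g t == b)) ->
  \sum_b marg P h (k b) = marg P f a.
Proof.
move=> hk; rewrite /marg [RHS](partition_big g xpredT) //=.
by apply: eq_bigr => b _; apply: eq_bigl => t; rewrite hk.
Qed.

End InformationDensity.

(** * Marginals of the joint law and the scheme that they define *)

Section SingleLetter.
Variables (R : realType) (X1 X2 Y2 Y3 V U : finType).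
Variables (W2 : X1 -> Y2 -> R) (W3 : X1 -> X2 -> Y2 -> Y3 -> R).
Hypothesis hW2 : (forall x1 y2, 0 <= W2 x1 y2) /\
  (forall x1, \sum_(y2 : Y2) W2 x1 y2 = 1).
Hypothesis hW3 : (forall x1 x2 y2 y3, 0 <= W3 x1 x2 y2 y3) /\
  (forall x1 x2 y2, \sum_(y3 : Y3) W3 x1 x2 y2 y3 = 1).
Variables (pVX : V -> X1 -> R) (pU : V -> Y2 -> U -> R).
Variable x2f : U -> V -> Y2 -> X2.
Hypothesis hpVX : (forall v x1, 0 <= pVX v x1) /\
  \sum_(v : V) \sum_(x1 : X1) pVX v x1 = 1.
Hypothesis hpU : (forall v y2 u, 0 <= pU v y2 u) /\
  (forall v y2, \sum_(u : U) pU v y2 u = 1).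

Local Notation Om := (omega X1 Y2 Y3 V U).
Local Notation P := (joint W2 W3 pVX pU x2f).
Local Notation mg f a := (marg P f a).

Lemma joint_ge0 t : 0 <= P t.
Proof.
by rewrite !mulr_ge0 ?(proj1 hW2) ?(proj1 hW3) ?(proj1 hpVX) ?(proj1 hpU).
Qed.

Definition fV (t : Om) := rvV t.
Definition fVX (t : Om) := (rvV t, rvX1 t).
Definition fVU (t : Om) := (rvV t, rvU t).
Definition fY (t : Om) := rvY2 t.
Definition fVY (t : Om) := (rvV t, rvY2 t).
Definition fVYU (t : Om) := (rvV t, rvY2 t, rvU t).
Definition fVXY (t : Om) := (rvV t, rvX1 t, rvY2 t).
Definition fVXYU (t : Om) := (rvV t, rvX1 t, rvY2 t, rvU t).
Definition fVXUZ (t : Om) := (rvV t, rvX1 t, rvU t, rvY3 t).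
Definition fVXZ (t : Om) := (rvV t, rvX1 t, rvY3 t).
Definition fVUZ (t : Om) := (rvV t, rvU t, rvY3 t).
Definition fVZ (t : Om) := (rvV t, rvY3 t).
Definition fZ (t : Om) := rvY3 t.

(** The next marginals come from the factorization of the joint law read backwards: y3, u and y2 are
    summed out in this order. *)
Lemma marg_VXYU v x y u : mg fVXYU (v, x, y, u) = pVX v x * W2 x y * pU v y u.
Proof.
rewrite -(@sum_marg _ _ P _ _ _ fVXYU (@rvY3 _ _ _ _ _) id
  (fun z => (v, x, y, u, z))); last first.
  by move=> [[[[? ?] ?] ?] ?] ?; rewrite /fVXYU !xpair_eqE.
under eq_bigr => z _ do rewrite marg_id /joint /rvV /rvX1 /rvY2 /rvU /rvY3 /=.
by rewrite -mulr_sumr (proj2 hW3) mulr1.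
Qed.

Lemma marg_VXY v x y : mg fVXY (v, x, y) = pVX v x * W2 x y.
Proof.
rewrite -(@sum_marg _ _ P _ _ _ fVXY (@rvU _ _ _ _ _) fVXYU
  (fun u => (v, x, y, u))); last by move=> t u; rewrite /fVXYU /fVXY !xpair_eqE.
under eq_bigr => u _ do rewrite marg_VXYU.
by rewrite -mulr_sumr (proj2 hpU) mulr1.
Qed.

Lemma marg_VX v x : mg fVX (v, x) = pVX v x.
Proof.
rewrite -(@sum_marg _ _ P _ _ _ fVX (@rvY2 _ _ _ _ _) fVXY
  (fun y => (v, x, y))); last by move=> t y; rewrite /fVXY /fVX !xpair_eqE.
under eq_bigr => y _ do rewrite marg_VXY.
by rewrite -mulr_sumr (proj2 hW2) mulr1.
Qed.

Lemma marg_VY v y : mg fVY (v, y) = \sum_x pVX v x * W2 x y.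
Proof.
rewrite -(@sum_marg _ _ P _ _ _ fVY (@rvX1 _ _ _ _ _) fVXY
  (fun x => (v, x, y))).
  by under eq_bigr => x _ do rewrite marg_VXY.
by move=> t x; rewrite /fVXY /fVY !xpair_eqE andbAC.
Qed.

(** U and X1 are independent given V and Y2, so the kernel of U comes out of the sum over x1. *)
Lemma marg_VYU v y u : mg fVYU (v, y, u) = mg fVY (v, y) * pU v y u.
Proof.
rewrite -(@sum_marg _ _ P _ _ _ fVYU (@rvX1 _ _ _ _ _) fVXYU
  (fun x => (v, x, y, u))).
  by under eq_bigr => x _ do rewrite marg_VXYU; rewrite marg_VY mulr_suml.
move=> t x; rewrite /fVXYU /fVYU !xpair_eqE.
by rewrite -!andbA; congr andb; rewrite andbC -andbA.
Qed.

Lemma sum_joint : \sum_t P t = 1.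
Proof.
rewrite -(proj2 hpVX) (partition_big fV xpredT) //=; apply: eq_bigr => v _.
rewrite (partition_big (@rvX1 _ _ _ _ _) xpredT) //=; apply: eq_bigr => x _.
by rewrite -marg_VX; apply: eq_bigl => t; rewrite /fVX xpair_eqE.
Qed.

Lemma marg_V_x v : \sum_x mg fVX (v, x) = mg fV v.
Proof.
by apply: (@sum_marg _ _ P _ _ _ _ (@rvX1 _ _ _ _ _)) => t x;
  rewrite /fVX xpair_eqE.
Qed.

Lemma marg_V_u v : \sum_u mg fVU (v, u) = mg fV v.
Proof.
by apply: (@sum_marg _ _ P _ _ _ _ (@rvU _ _ _ _ _)) => t x;
  rewrite /fVU xpair_eqE.
Qed.

Lemma marg_V_sum : \sum_v mg fV v = 1.
Proof. by rewrite -sum_joint [RHS](partition_big fV xpredT). Qed.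

(* Conditional laws of X1 and U given V, completed by a point mass where the law
   of V vanishes. *)
Definition kerX (x0 : X1) v x : R :=
  if mg fV v == 0 then (x == x0)%:R else mg fVX (v, x) / mg fV v.
Definition kerU (u0 : U) v u : R :=
  if mg fV v == 0 then (u == u0)%:R else mg fVU (v, u) / mg fV v.

Lemma kerX_ge0 x0 v x : 0 <= kerX x0 v x.
Proof.
rewrite /kerX; case: ifP => _; first by rewrite ler0n.
by rewrite divr_ge0 // marg_ge0 //; apply: joint_ge0.
Qed.

Lemma kerU_ge0 u0 v u : 0 <= kerU u0 v u.
Proof.
rewrite /kerU; case: ifP => _; first by rewrite ler0n.
by rewrite divr_ge0 // marg_ge0 //; apply: joint_ge0.
Qed.

Lemma sum_eq_indicator (T : finType) (t0 : T) : \sum_t (t == t0)%:R = 1 :> R.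
Proof. by rewrite (bigD1 t0) //= eqxx big1 ?addr0 // => t /negPf ->. Qed.

Lemma kerX_sum x0 v : \sum_x kerX x0 v x = 1.
Proof.
rewrite /kerX; have [_|m0] := eqVneq (mg fV v) 0; first exact: sum_eq_indicator.
by rewrite -mulr_suml marg_V_x divff.
Qed.

Lemma kerU_sum u0 v : \sum_u kerU u0 v u = 1.
Proof.
rewrite /kerU; have [_|m0] := eqVneq (mg fV v) 0; first exact: sum_eq_indicator.
by rewrite -mulr_suml marg_V_u divff.
Qed.

Lemma marg_eq0 (A B : finType) (f : Om -> A) (g : Om -> B) a b :
  (forall t, g t = b -> f t = a) -> mg f a = 0 -> mg g b = 0.
Proof.
move=> fg m0; apply: big1 => t /eqP /fg ft.
have Pt := marg_ge joint_ge0 f t.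
by apply: le_anti; rewrite joint_ge0 andbT; move: Pt; rewrite ft m0.
Qed.

Lemma mul_div_le (x y : R) : 0 <= y -> x * (y / x) <= y.
Proof.
move=> y0; have [->|x0] := eqVneq x 0; first by rewrite mul0r.
by rewrite mulrC divfK.
Qed.

(** Bayes: p(y2|u,v)/p(y2|v) = p(u|v,y2)/p(u|v), which converts the codeword law into the joint law.
    If p(v,y2) or p(u,v) vanishes, both sides are zero. *)
Lemma jointE x0 u0 v x y u z :
  mg fV v * kerX x0 v x * W2 x y * kerU u0 v u *
    ((mg fVYU (v, y, u) / (mg fV v * kerU u0 v u)) /
     (mg fVY (v, y) / mg fV v)) * W3 x (x2f u v y) y z = P (v, x, y, u, z).
Proof.
rewrite /joint /rvV /rvX1 /rvY2 /rvU /rvY3 /=.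
have [VY0|VYn0] := eqVneq (mg fVY (v, y)) 0.
  have xy0 : pVX v x * W2 x y = 0.
    rewrite -marg_VXY; apply: marg_eq0 VY0 => t [].
    by rewrite /fVY => -> _ ->.
  by rewrite xy0 VY0 !(mul0r, mulr0, invr0).
have Vn0 : mg fV v != 0.
  by apply: contra_neq VYn0; apply: marg_eq0 => t [].
have [VU0|VUn0] := eqVneq (mg fVU (v, u)) 0.
  have : mg fVYU (v, y, u) = 0.
    by apply: marg_eq0 VU0 => t []; rewrite /fVU => -> _ ->.
  rewrite marg_VYU => /eqP; rewrite mulf_eq0 (negPf VYn0) /= => /eqP ->.
  by rewrite /kerU (negPf Vn0) VU0 !(mul0r, mulr0).
rewrite /kerX /kerU (negPf Vn0) marg_VX marg_VYU.
by field; rewrite Vn0 VUn0 VYn0.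
Qed.

Lemma sum5_exchange (g : V -> X1 -> Y2 -> U -> Y3 -> R) :
  \sum_y \sum_z \sum_v \sum_x \sum_u g v x y u z =
  \sum_v \sum_x \sum_u \sum_y \sum_z g v x y u z.
Proof.
rewrite pair_bigA exchange_big; apply: eq_bigr => v _ /=.
rewrite exchange_big; apply: eq_bigr => x _ /=.
rewrite exchange_big; apply: eq_bigr => u _ /=.
by rewrite -(pair_bigA _ (fun y z => g v x y u z)).
Qed.

Lemma sum5_omega (g : V -> X1 -> Y2 -> U -> Y3 -> R) :
  \sum_y \sum_z \sum_v \sum_x \sum_u g v x y u z =
  \sum_(t : Om) g (rvV t) (rvX1 t) (rvY2 t) (rvU t) (rvY3 t).
Proof.
rewrite sum5_exchange.
under eq_bigr => v _ do under eq_bigr => x _ do rewrite exchange_big.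
by rewrite !pair_bigA.
Qed.

(** The metrics divide by the completed kernels themselves, so that each average cancels termwise by
    [mul_div_le]. The definition is transparent so that the ratios unfold to marginals. *)
Definition channel_scheme (x0 : X1) (u0 : U) : scheme W2 W3 x2f.
Proof.
refine (@Scheme R X1 X2 Y2 Y3 V U W2 W3 x2f
  (fun v => mg fV v) (kerX x0) (kerU u0) (fun y => mg fY y)
  (fun v y => mg fVY (v, y) / mg fV v)
  (fun v u y => mg fVYU (v, y, u) / (mg fV v * kerU u0 v u))
  (fun v x u z => mg fVXUZ (v, x, u, z) /
     (mg fV v * kerU u0 v u * kerX x0 v x))
  (fun v u z => mg fVUZ (v, u, z) / (mg fV v * kerU u0 v u))
  (fun v z => mg fVZ (v, z) / mg fV v) (fun z => mg fZ z)
  _ _ _ _ _ _ _ _ _ _ _ _ _ _ _ _ _ _ _ _).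
all: have mge0 (A : finType) (f : Om -> A) a : 0 <= mg f a
  by apply: marg_ge0; apply: joint_ge0.
- exact: (proj1 hW2).
- exact: (proj2 hW2).
- exact: (proj1 hW3).
- exact: (proj2 hW3).
- by move=> v; apply: mge0.
- exact: marg_V_sum.
- exact: kerX_ge0.
- exact: kerX_sum.
- exact: kerU_ge0.
- exact: kerU_sum.
- by move=> v y; rewrite divr_ge0.
- by move=> v u y; rewrite divr_ge0 // mulr_ge0 // kerU_ge0.
- by move=> v x u z; rewrite divr_ge0 // !mulr_ge0 ?kerU_ge0 ?kerX_ge0.
- move=> y; rewrite -(@sum_marg _ _ P _ _ _ fY (@rvV _ _ _ _ _) fVY
    (fun v => (v, y))); last by move=> t v; rewrite /fVY xpair_eqE andbC.
  by apply: ler_sum => v _; apply: mul_div_le.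
- move=> v y; rewrite -(@sum_marg _ _ P _ _ _ fVY (@rvU _ _ _ _ _) fVYU
    (fun u => (v, y, u))); last by move=> t u; rewrite /fVYU /fVY !xpair_eqE.
  rewrite [X in _ <= X]mulr_suml; apply: ler_sum => u _; rewrite invfM [mg _ _ * (_ / _)]mulrA.
  by apply: mul_div_le; rewrite divr_ge0.
- move=> v u z; rewrite -(@sum_marg _ _ P _ _ _ fVUZ (@rvX1 _ _ _ _ _) fVXUZ
    (fun x => (v, x, u, z))); last first.
    move=> t x; rewrite /fVXUZ /fVUZ !xpair_eqE.
    by rewrite -!andbA; congr andb; rewrite andbC -andbA.
  rewrite [X in _ <= X]mulr_suml; apply: ler_sum => x _; rewrite invfM [mg _ _ * (_ / _)]mulrA.
  by apply: mul_div_le; rewrite divr_ge0 // mulr_ge0 // kerU_ge0.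
- move=> v z; rewrite -(@sum_marg _ _ P _ _ _ fVZ (@rvX1 _ _ _ _ _) fVXZ
    (fun x => (v, x, z))); last first.
    by move=> t x; rewrite /fVXZ /fVZ !xpair_eqE andbAC.
  rewrite [X in _ <= X]mulr_suml; apply: ler_sum => x _.
  rewrite -(@sum_marg _ _ P _ _ _ fVXZ (@rvU _ _ _ _ _) fVXUZ
    (fun u => (v, x, u, z))); last first.
    by move=> t u; rewrite /fVXUZ /fVXZ !xpair_eqE andbAC.
  rewrite [X in _ <= X]mulr_suml; apply: ler_sum => u _.
  rewrite -[mg fV v * _ * _]mulrA [kerX _ _ _ * _]mulrC invfM [mg _ _ * (_ / _)]mulrA.
  by apply: mul_div_le; rewrite divr_ge0.
- move=> z; rewrite -(@sum_marg _ _ P _ _ _ fZ (@rvV _ _ _ _ _) fVZ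
    (fun v => (v, z))); last by move=> t v; rewrite /fVZ xpair_eqE andbC.
  apply: ler_sum => v _.
  rewrite -(@sum_marg _ _ P _ _ _ fVZ (@rvX1 _ _ _ _ _) fVXZ
    (fun x => (v, x, z))); last first.
    by move=> t x; rewrite /fVXZ /fVZ !xpair_eqE andbAC.
  apply: ler_sum => x _.
  rewrite -(@sum_marg _ _ P _ _ _ fVXZ (@rvU _ _ _ _ _) fVXUZ
    (fun u => (v, x, u, z))); last first.
    by move=> t u; rewrite /fVXUZ /fVXZ !xpair_eqE andbAC.
  apply: ler_sum => u _; rewrite [_ * kerU _ _ _ * kerX _ _ _]mulrAC.
  exact: mul_div_le.
- move=> v x y u z /= jn0; move: (jn0); rewrite jointE => Pn0.
  rewrite !mulf_eq0 !negb_or -!andbA in jn0.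
  case/and5P: jn0 => v0 x0' _ k0 _.
  rewrite mulf_neq0 ?invr_neq0 ?mulf_neq0 //.
  rewrite lt0r_neq0 // (lt_le_trans _ (marg_ge joint_ge0 fVXUZ (v, x, y, u, z))) //.
  by rewrite lt_def Pn0 joint_ge0.
- rewrite sum5_omega -[RHS]sum_joint; apply: eq_bigr => t _ /=.
  by rewrite jointE -!surjective_pairing.
Defined.

(** * Mean log-ratios as mutual informations, and the choice of rates *)

Section Rates.
Variables (x0 : X1) (u0 : U).
Local Notation S := (channel_scheme x0 u0).

Lemma channel_jointE v x y u z : joint_of S v x y u z = P (v, x, y, u, z).
Proof. exact: jointE. Qed.

Lemma channel_mean5E g : mean5 S g =
  \sum_(t : Om) P t * g (rvV t) (rvX1 t) (rvY2 t) (rvU t) (rvY3 t).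
Proof.
rewrite /mean5 sum5_omega; apply: eq_bigr => t _.
by rewrite channel_jointE -!surjective_pairing.
Qed.

Lemma kerXE v x : mg fV v != 0 -> kerX x0 v x = mg fVX (v, x) / mg fV v.
Proof. by rewrite /kerX => /negPf ->. Qed.

Lemma kerUE v u : mg fV v != 0 -> kerU u0 v u = mg fVU (v, u) / mg fV v.
Proof. by rewrite /kerU => /negPf ->. Qed.

Lemma marg_neq0 t (A : finType) (f : Om -> A) : P t != 0 -> mg f (f t) != 0.
Proof.
move=> Pt; rewrite lt0r_neq0 // (lt_le_trans _ (marg_ge joint_ge0 f t)) //.
by rewrite lt_def Pt joint_ge0.
Qed.

Lemma marg_eq (A : finType) (f : Om -> A) a (Q : pred Om) :
  (forall t, Q t = (f t == a)) -> \sum_(t | Q t) P t = mg f a.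
Proof. by move=> Qf; apply: eq_bigl. Qed.

Lemma cond_ratio_gt0 (TA TB TC : finType) (A : Om -> TA) (B : Om -> TB)
    (C : Om -> TC) t : P t != 0 -> 0 < cond_ratio P A B C t.
Proof.
move=> Pt; have Pgt0 : 0 < P t by rewrite lt_def Pt joint_ge0.
have sgt0 (Q : pred Om) : Q t -> 0 < \sum_(t' | Q t') P t'.
  move=> Qt; rewrite (bigD1 t) //= ltr_pwDl // sumr_ge0 // => *.
  exact: joint_ge0.
by rewrite /cond_ratio divr_gt0 // mulr_gt0 // sgt0 ?eqxx.
Qed.

Lemma mutinfo_ln (TA TB TC : finType) (A : Om -> TA) (B : Om -> TB)
    (C : Om -> TC) :
  \sum_t P t * ln (cond_ratio P A B C t) = cond_mutinfo P A B C * ln 2.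
Proof.
rewrite (cond_mutinfoE _ _ _ joint_ge0) mulr_suml; apply: eq_bigr => t _.
rewrite /log2 -mulrA divfK // lt0r_neq0 // ln_gt0 // ltr1n //.
Qed.

Lemma cond_ratioE (TA TB TC T1 T2 T3 T4 : finType) (A : Om -> TA)
    (B : Om -> TB) (C : Om -> TC) (fabc : Om -> T1) (fc : Om -> T2)
    (fac : Om -> T3) (fbc : Om -> T4) t :
  (forall t', (A t' == A t) && (B t' == B t) && (C t' == C t) =
              (fabc t' == fabc t)) ->
  (forall t', (C t' == C t) = (fc t' == fc t)) ->
  (forall t', (A t' == A t) && (C t' == C t) = (fac t' == fac t)) ->
  (forall t', (B t' == B t) && (C t' == C t) = (fbc t' == fbc t)) ->
  cond_ratio P A B C t =
  mg fabc (fabc t) * mg fc (fc t) / (mg fac (fac t) * mg fbc (fbc t)).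
Proof.
move=> h1 h2 h3 h4; rewrite /cond_ratio.
by congr (_ * _ / (_ * _)); apply: marg_eq.
Qed.

Lemma marg_unit : mg (fun=> tt) tt = 1.
Proof. by rewrite -sum_joint; apply: eq_bigl. Qed.

Local Notation I_V_Y2 := (mutinfo P (fun t => rvV t) (fun t => rvY2 t)).
Local Notation I_U_Y2_V :=
  (cond_mutinfo P (fun t => rvU t) (fun t => rvY2 t) (fun t => rvV t)).
Local Notation I_X1_UY3_V := (cond_mutinfo P (fun t => rvX1 t)
  (fun t => (rvU t, rvY3 t)) (fun t => rvV t)).
Local Notation I_U_Y3_V :=
  (cond_mutinfo P (fun t => rvU t) (fun t => rvY3 t) (fun t => rvV t)).
Local Notation I_VU_Y3 :=
  (mutinfo P (fun t => (rvV t, rvU t)) (fun t => rvY3 t)).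

(** p(y2)/p(y2|v) is the inverse of the ratio inside I(V;Y2), hence the sign. *)
Lemma mean_ratioA :
  mean5 S (fun v x y u z => ln (ratioA S v x y u z)) = - I_V_Y2 * ln 2.
Proof.
rewrite channel_mean5E mulNr -mutinfo_ln -sumrN; apply: eq_bigr => t _.
have [->|Pt] := eqVneq (P t) 0; first by rewrite !mul0r oppr0.
rewrite -mulrN -lnV ?posrE ?cond_ratio_gt0 //; congr (_ * ln _).
have nV := marg_neq0 fV Pt; have nVY := marg_neq0 fVY Pt.
have nY := marg_neq0 fY Pt.
rewrite (@cond_ratioE _ _ _ _ _ _ _ _ _ _ fVY (fun=> tt) fV fY) => [||||].
  rewrite marg_unit /ratioA /=; move: nV nVY nY.
  rewrite /fV /fVY /fY => nV nVY nY; by field; rewrite nV nVY nY.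
all: by move=> t' //=; rewrite /fVY ?xpair_eqE ?eqxx ?andbT.
Qed.

Lemma mean_ratioB :
  mean5 S (fun v x y u z => ln (ratioB S v x y u z)) = I_U_Y2_V * ln 2.
Proof.
rewrite channel_mean5E -mutinfo_ln; apply: eq_bigr => t _.
have [->|Pt] := eqVneq (P t) 0; first by rewrite !mul0r.
congr (_ * ln _).
have nV := marg_neq0 fV Pt; have nVY := marg_neq0 fVY Pt.
have nVU := marg_neq0 fVU Pt.
rewrite (@cond_ratioE _ _ _ _ _ _ _ _ _ _ fVYU fV fVU fVY) => [||||].
  rewrite /ratioB /= kerUE //; move: nV nVY nVU.
  rewrite /fV /fVY /fVU => nV nVY nVU; by field; rewrite nV nVY nVU.
all: move=> t' //=; rewrite /fVYU /fVU /fVY ?xpair_eqE //.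
all: by do 3?case: (_ == _).
Qed.

Lemma mean_ratio1 :
  mean5 S (fun v x y u z => ln (ratio1 S v x y u z)) = - I_X1_UY3_V * ln 2.
Proof.
rewrite channel_mean5E mulNr -mutinfo_ln -sumrN; apply: eq_bigr => t _.
have [->|Pt] := eqVneq (P t) 0; first by rewrite !mul0r oppr0.
rewrite -mulrN -lnV ?posrE ?cond_ratio_gt0 //; congr (_ * ln _).
have nV := marg_neq0 fV Pt; have nVX := marg_neq0 fVX Pt.
have nVU := marg_neq0 fVU Pt; have nVUZ := marg_neq0 fVUZ Pt.
have nVXUZ := marg_neq0 fVXUZ Pt.
rewrite (@cond_ratioE _ _ _ _ _ _ _ _ _ _ fVXUZ fV fVX fVUZ) => [||||].
  rewrite /ratio1 /= kerUE // kerXE //; move: nV nVX nVU nVUZ nVXUZ.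
  rewrite /fV /fVX /fVU /fVUZ /fVXUZ => nV nVX nVU nVUZ nVXUZ.
  by field; rewrite nV nVX nVU nVUZ nVXUZ.
all: move=> t' //=; rewrite /fVXUZ /fVX /fVUZ ?xpair_eqE //.
all: by do 4?case: (_ == _).
Qed.

(** The ratio splits as (q1/qd)(q2/q1), and q2/q1 = p(y3|v)/p(y3|u,v) inverts the ratio inside
    I(U;Y3|V). *)
Lemma mean_ratio2 : mean5 S (fun v x y u z => ln (ratio2 S v x y u z)) =
  - (I_X1_UY3_V + I_U_Y3_V) * ln 2.
Proof.
rewrite mulNr mulrDl opprD -mulNr -mean_ratio1 !channel_mean5E.
rewrite -mutinfo_ln -sumrN -big_split; apply: eq_bigr => t _ /=.
have [->|Pt] := eqVneq (P t) 0; first by rewrite !mul0r subr0.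
have jn0 : joint_of S (rvV t) (rvX1 t) (rvY2 t) (rvU t) (rvY3 t) != 0.
  by rewrite channel_jointE -!surjective_pairing.
have [_ _ r1_gt0 _ _] := ratios_gt0 jn0.
rewrite -mulrN -mulrDr -lnV ?posrE ?cond_ratio_gt0 //.
rewrite -lnM ?posrE ?invr_gt0 ?cond_ratio_gt0 //; congr (_ * ln _).
have nV := marg_neq0 fV Pt; have nVX := marg_neq0 fVX Pt.
have nVU := marg_neq0 fVU Pt; have nVUZ := marg_neq0 fVUZ Pt.
have nVXUZ := marg_neq0 fVXUZ Pt; have nVZ := marg_neq0 fVZ Pt.
rewrite (@cond_ratioE _ _ _ _ _ _ _ _ _ _ fVUZ fV fVU fVZ) => [||||].
  rewrite /ratio2 /ratio1 /= kerUE // kerXE //.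
  move: nV nVX nVU nVUZ nVXUZ nVZ.
  rewrite /fV /fVX /fVU /fVUZ /fVXUZ /fVZ => nV nVX nVU nVUZ nVXUZ nVZ.
  by field; rewrite nV nVX nVU nVUZ nVXUZ nVZ.
all: move=> t' //=; rewrite /fVUZ /fVU /fVZ ?xpair_eqE //.
all: by do 3?case: (_ == _).
Qed.

(** The ratio splits as (q1/qd)(q3/q1), and q3/q1 = p(y3)/p(y3|u,v) inverts the ratio inside
    I(V,U;Y3). *)
Lemma mean_ratio3 : mean5 S (fun v x y u z => ln (ratio3 S v x y u z)) =
  - (I_X1_UY3_V + I_VU_Y3) * ln 2.
Proof.
rewrite mulNr mulrDl opprD -mulNr -mean_ratio1 !channel_mean5E.
rewrite -mutinfo_ln -sumrN -big_split; apply: eq_bigr => t _ /=.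
have [->|Pt] := eqVneq (P t) 0; first by rewrite !mul0r subr0.
have jn0 : joint_of S (rvV t) (rvX1 t) (rvY2 t) (rvU t) (rvY3 t) != 0.
  by rewrite channel_jointE -!surjective_pairing.
have [_ _ r1_gt0 _ _] := ratios_gt0 jn0.
rewrite -mulrN -mulrDr -lnV ?posrE ?cond_ratio_gt0 //.
rewrite -lnM ?posrE ?invr_gt0 ?cond_ratio_gt0 //; congr (_ * ln _).
have nV := marg_neq0 fV Pt; have nVX := marg_neq0 fVX Pt.
have nVU := marg_neq0 fVU Pt; have nVUZ := marg_neq0 fVUZ Pt.
have nVXUZ := marg_neq0 fVXUZ Pt; have nZ := marg_neq0 fZ Pt.
rewrite (@cond_ratioE _ _ _ _ _ _ _ _ _ _ fVUZ (fun=> tt) fVU fZ) => [||||].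
  rewrite marg_unit /ratio3 /ratio1 /= kerUE // kerXE //.
  move: nV nVX nVU nVUZ nVXUZ nZ.
  rewrite /fV /fVX /fVU /fVUZ /fVXUZ /fZ => nV nVX nVU nVUZ nVXUZ nZ.
  by field; rewrite nV nVX nVU nVUZ nVXUZ nZ.
all: by move=> t' //=; rewrite /fVUZ /fVU ?xpair_eqE ?eqxx ?andbT.
Qed.

(** Use ln r >= 1 - 1/r; multiplying the joint law by 1/r gives at most the law with independent
    codewords, so the mean of 1/r is at most one. This keeps the rate of l nonnegative. *)
Lemma mean_ratioB_ge0 :
  0 <= mean5 S (fun v x y u z => ln (ratioB S v x y u z)).
Proof.
have le1 : mean5 S (fun v x y u z => (ratioB S v x y u z)^-1) <= 1.
  apply: (@le_trans _ _ (\sum_y \sum_z \sum_v \sum_x \sum_u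
     pV S v * pX S v x * pUV S v u * W2 x y * W3 x (x2f u v y) y z)).
    do 5 (apply: ler_sum => ? _); rewrite /joint_of /ratioB.
    set r := wu _ _ _ _ / _; set p := pV _ _ * _ * _; set k := pUV _ _ _.
    set w := W3 _ _ _ _.
    have r1 : r * r^-1 <= 1 by exact: divff_le1.
    have pkw : 0 <= p * k * w.
      have W2p := proj1 hW2; have W3p := proj1 hW3.
      apply: mulr_ge0; last exact: W3p.
      apply: mulr_ge0; last exact: pUV_ge0.
      apply: mulr_ge0; last exact: W2p.
      by apply: mulr_ge0; [apply: pV_ge0|apply: pX_ge0].
    have -> : p * k * r * w * r^-1 = (p * k * w) * (r * r^-1) by ring.
    apply: le_trans (ler_wpM2l pkw r1) _; rewrite mulr1.
    by apply: le_of_eq; rewrite /p; ring.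
  rewrite sum5_exchange -[X in _ <= X](pV_sum S).
  apply: le_of_eq; apply: eq_bigr => v _.
  rewrite -[RHS]mulr1 -(pX_sum S v) mulr_sumr; apply: eq_bigr => x _.
  rewrite -[RHS]mulr1 -(pUV_sum S v) mulr_sumr; apply: eq_bigr => u _.
  under eq_bigr => y _ do rewrite -mulr_sumr (proj2 hW3) mulr1.
  by rewrite -mulr_sumr (proj2 hW2) mulr1.
have : 1 - mean5 S (fun v x y u z => (ratioB S v x y u z)^-1) <=
    mean5 S (fun v x y u z => ln (ratioB S v x y u z)); last by lra.
rewrite -[X in X - _](joint_sum S) /mean5.
rewrite -sumrB; apply: ler_sum => y _; rewrite -sumrB; apply: ler_sum => z _.
rewrite -sumrB; apply: ler_sum => v _; rewrite -sumrB; apply: ler_sum => x _.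
rewrite -sumrB; apply: ler_sum => u _; set J := joint_of _ _ _ _ _ _.
have [J0|Jn0] := eqVneq J 0; first by rewrite J0 !mul0r subr0.
have [_ rB _ _ _] := ratios_gt0 Jn0.
rewrite -[X in X - _]mulr1 -mulrBr; apply: ler_wpM2l; first exact: joint_of_ge0.
have := expR_ge1Dx (- ln (ratioB S v x y u z)).
by rewrite expRN lnK ?posrE //; lra.
Qed.

(** Eliminates the three partial rates from the five conditions. The bounds come, in order, from the
    list with m' at the receiver, from m' at the relay with m'' for the true l, and from m' at the
    relay, the list and m'' for a wrong l. *)
Lemma achievable_of_lt_min rate :
  rate < Num.min (I_VU_Y3 + I_X1_UY3_V - I_U_Y2_V)
    (Num.min (I_V_Y2 + I_X1_UY3_V)
             (I_V_Y2 + I_X1_UY3_V + I_U_Y3_V - I_U_Y2_V)) ->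
  achievable W2 W3 rate.
Proof.
rewrite !lt_min => /and3P[].
have : 0 <= I_U_Y2_V.
  have := mean_ratioB_ge0; rewrite mean_ratioB pmulr_lge0 //.
  by rewrite ln_gt0 // ltr1n.
have mA := mean_ratioA; have mB := mean_ratioB; have m1 := mean_ratio1.
have m2 := mean_ratio2; have m3 := mean_ratio3.
move: (I_V_Y2) (I_U_Y2_V) (I_X1_UY3_V) (I_U_Y3_V) (I_VU_Y3) mA mB m1 m2 m3.
move=> IA IB I1 I2 I3 mA mB m1 m2 m3 IB0 b1 b2 b3.
have ln2 : 0 < ln 2 :> R by rewrite ln_gt0 // ltr1n.
(* A third of the least slack: at most two losses of [d] occur in a condition, one in [r1] and one
   in the rate of l, so a margin remains. *)
pose d := Num.min (I3 + I1 - IB - rate)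
  (Num.min (IA + I1 - rate) (IA + I1 + I2 - IB - rate)) / 3.
have d0 : 0 < d by rewrite divr_gt0 // !lt_min; apply/and3P; split; lra.
have d1 : 3 * d <= I3 + I1 - IB - rate.
  by rewrite /d mulrC divfK // ge_min lexx.
have d2 : 3 * d <= IA + I1 - rate.
  by rewrite /d mulrC divfK // !ge_min lexx !orbT.
have d3 : 3 * d <= IA + I1 + I2 - IB - rate.
  by rewrite /d mulrC divfK // !ge_min lexx !orbT.
(* The relay is given as much of the message as it can decode with margin [d], and m'' carries the
   rest. A positive [r2] thus means that [r1] has reached IA - d; clipping at zero covers IA < d and
   negative rates. *)
pose r1 := Num.max 0 (Num.min rate (IA - d)).
pose r2 := Num.max 0 (rate - r1).
have r1_ge0 : 0 <= r1 by rewrite le_max lexx.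
have r2_ge0 : 0 <= r2 by rewrite le_max lexx.
have r1_gt0 : 0 < r1 -> r1 <= rate /\ r1 <= IA - d.
  by rewrite /r1 maxEle minEle; do 2 case: ifP; move=> *; split; lra.
have r1_lb : rate <= r1 \/ IA - d <= r1.
  rewrite /r1 maxEle minEle.
  by do 2 case: ifP; move=> *; [left|right|left|right]; lra.
have r12 : rate <= r1 + r2.
  by rewrite -lerBlDl /r2 le_max lexx orbT.
have r2_gt0 : 0 < r2 -> r2 = rate - r1 /\ IA - d <= r1.
  rewrite /r2 maxEle; case: ifP => [h|]; last by rewrite ltxx.
  by move=> lt; split=> //; case: r1_lb => //; lra.
have r2_cases : r2 = 0 \/ r2 = rate - r1.
  by rewrite /r2 maxEle; case: ifP; [right|left].
apply: (@scheme_achievable _ _ _ _ _ _ _ _ _ _ S rate r1 r2 (IB + d)) => //.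
- by lra.
- by move=> /r1_gt0[h1 h2]; rewrite mA -mulrDl pmulr_llt0 //; lra.
- by rewrite mB -mulrBl pmulr_llt0 //; lra.
- by move=> /r2_gt0[h1 h2]; rewrite m1 -mulrDl pmulr_llt0 //; lra.
- by move=> /r2_gt0[h1 h2]; rewrite m2 -mulrDl pmulr_llt0 //; lra.
- move=> /r1_gt0[h1 h2]; rewrite m3 -mulrDl pmulr_llt0 //.
  by case: r2_cases => ->; lra.
Qed.

End Rates.
End SingleLetter.

(** * Passage to the supremum of achievable rates *)

Lemma inhabited_of_sum1 (R : realType) (T : finType) (p : T -> R) :
  \sum_t p t = 1 -> exists t : T, True.
Proof.
case: (pickP (@predT T)) => [t _|none]; first by exists t.
by rewrite big_pred0 // => /esym /eqP; rewrite oner_eq0.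
Qed.

Theorem theorem3 (R : realType) (X1 X2 Y2 Y3 : finType)
  (W2 : X1 -> Y2 -> R) (W3 : X1 -> X2 -> Y2 -> Y3 -> R)
  (hW2 : (forall x1 y2, 0 <= W2 x1 y2) /\ (forall x1, \sum_(y2 : Y2) W2 x1 y2 = 1))
  (hW3 : (forall x1 x2 y2 y3, 0 <= W3 x1 x2 y2 y3) /\
         (forall x1 x2 y2, \sum_(y3 : Y3) W3 x1 x2 y2 y3 = 1))
  (V U : finType) (pVX : V -> X1 -> R) (pU : V -> Y2 -> U -> R)
  (x2f : U -> V -> Y2 -> X2)
  (hpVX : (forall v x1, 0 <= pVX v x1) /\ \sum_(v : V) \sum_(x1 : X1) pVX v x1 = 1)
  (hpU : (forall v y2 u, 0 <= pU v y2 u) /\ (forall v y2, \sum_(u : U) pU v y2 u = 1)) :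
  let P := joint W2 W3 pVX pU x2f in
  let I_VU_Y3 := mutinfo P (fun t => (rvV t, rvU t)) (fun t => rvY3 t) in
  let I_X1_UY3_V := cond_mutinfo P (fun t => rvX1 t) (fun t => (rvU t, rvY3 t)) (fun t => rvV t) in
  let I_U_Y2_V := cond_mutinfo P (fun t => rvU t) (fun t => rvY2 t) (fun t => rvV t) in
  let I_V_Y2 := mutinfo P (fun t => rvV t) (fun t => rvY2 t) in
  let I_U_Y3_V := cond_mutinfo P (fun t => rvU t) (fun t => rvY3 t) (fun t => rvV t) in
  ((Num.min (I_VU_Y3 + I_X1_UY3_V - I_U_Y2_V)
     (Num.min (I_V_Y2 + I_X1_UY3_V)
              (I_V_Y2 + I_X1_UY3_V + I_U_Y3_V - I_U_Y2_V)))%:E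
   <= capacity_noncausal W2 W3)%E.
Proof.
cbv zeta.
(* The normalized laws supply the points [x0] and [u0] at which the completed kernels put their
   point masses. *)
have := proj2 hpVX; rewrite pair_bigA => /inhabited_of_sum1[[v0 x0] _].
have [y0 _] := inhabited_of_sum1 (proj2 hW2 x0).
have [u0 _] := inhabited_of_sum1 (proj2 hpU v0 y0).
set m := Num.min _ _.
(* The strict inequality on rates suffices: m - e is achievable for every e > 0. *)
apply/lee_addgt0Pr => e e0; rewrite -leeBlDr //.
apply: ereal_sup_ubound; exists (m - e) => //.
apply: (achievable_of_lt_min hW2 hW3 hpVX hpU x0 u0).
have lt : m - e < m by rewrite gtrBl.
exact: lt.
Qed.
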